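(* Let $\mathbb{F}$ be a field with $\mathrm{char}(\mathbb{F})\neq 2,3$. Every ideal of $\hat{\mathcal{H}}$ is invariant under $\mathrm{Aut}(\hat{\mathcal{H}})$. In particular, every quotient of $\hat{\mathcal{H}}$ by a proper ideal, and so also every quotient of the Highwater algebra $\mathcal{H}$ by a proper ideal, is symmetric.
   Context: Notation: $\mathbb{N}=\{1,2,3,\dots\}$, $3\mathbb{N}=\{3,6,9,\dots\}$; for $r\in\mathbb{Z}$, $\bar r=r+3\mathbb{Z}\in\mathbb{Z}_3$. The algebra $\hat{\mathcal{H}}$ is the commutative $\mathbb{F}$-algebra with basis $\{a_i:i\in\mathbb{Z}\}\cup\{s_j:j\in\mathbb{N}\}\cup\{p_{\bar r,k}:\bar r\in\{\bar1,\bar2\},\ k\in 3\mathbb{N}\}$, where $s_0=0$, $p_{\bar r,j}=0$ for all $\bar r$ whenever $j\notin 3\mathbb{N}$, $p_{\bar 0,j}=-p_{\bar1,j}-p_{\bar2,j}$, $z_{\bar r,j}=p_{\bar r+\bar1,j}-p_{\bar r-\bar1,j}$, and for $i,i'\in\mathbb{Z}$, $j,l\in\mathbb{N}$, $h,k\in3\mathbb{N}$, $\bar r,\bar t\in\mathbb{Z}_3$: (H1) $a_ia_{i'}=\tfrac12(a_i+a_{i'})+s_{|i-i'|}+z_{\bar\imath,|i-i'|}$; (H2) $a_is_j=-\tfrac34a_i+\tfrac38(a_{i-j}+a_{i+j})+\tfrac32 s_j-z_{\bar\imath,j}$; (H3) $a_ip_{\bar r,k}=\tfrac32p_{\bar r,k}-p_{-(\bar\imath+\bar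 r),k}$; (H4) $s_js_l=\tfrac34(s_j+s_l)-\tfrac38(s_{|j-l|}+s_{j+l})$; (H5) $s_jp_{\bar r,k}=\tfrac34(p_{\bar r,j}+p_{\bar r,k})-\tfrac38(p_{\bar r,|j-k|}+p_{\bar r,j+k})$; (H6) $p_{\bar r,h}p_{\bar t,k}=\tfrac14(z_{-(\bar r+\bar t),h}+z_{-(\bar r+\bar t),k})-\tfrac18(z_{-(\bar r+\bar t),|h-k|}+z_{-(\bar r+\bar t),h+k})$. The Highwater algebra $\mathcal{H}$ is the commutative algebra with basis $\{a_i:i\in\mathbb{Z}\}\cup\{s_j:j\in\mathbb{N}\}$, $s_0=0$, and products $a_ia_{i'}=\tfrac12(a_i+a_{i'})+s_{|i-i'|}$, $a_is_j=-\tfrac34a_i+\tfrac38(a_{i-j}+a_{i+j})+\tfrac32s_j$, $s_js_l=\tfrac34(s_j+s_l)-\tfrac38(s_{|j-l|}+s_{j+l})$; it is $\hat{\mathcal{H}}/J$ with $J=\langle p_{\bar1,j},p_{\bar2,j}:j\in3\mathbb{N}\rangle$. A quotient $A$ of $\hat{\mathcal{H}}$ or $\mathcal{H}$ is called symmetric if $A$ is generated as an algebra by the images $\bar a_0,\bar a_1$ of $a_0,a_1$ and there is an involutory automorphism of $A$ interchanging $\bar a_0$ and $\bar a_1$. *)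

(* Defs.v *)
From HB Require Import structures.
From mathcomp Require Import all_boot all_order all_algebra.
Set Implicit Arguments. Unset Strict Implicit. Unset Printing Implicit Defensive.
Import Order.TTheory GRing.Theory Num.Theory.
Local Open Scope ring_scope.

Section Algebras.
Variable F : fieldType.

(* A (non-associative) F-algebra is an F-vector space V with a product m. *)
Definition comm_bilinear (V : lmodType F) (m : V -> V -> V) : Prop :=
  (forall x y, m x y = m y x) /\
  (forall (a : F) x y z, m (a *: x + y) z = a *: m x z + m y z).

Definition alg_hom (V W : lmodType F) (mV : V -> V -> V) (mW : W -> W -> W)
  (f : V -> W) : Prop :=
  (forall (a : F) x y, f (a *: x + y) = a *: f x + f y) /\
  (forall x y, f (mV x y) = mW (f x) (f y)).

Definition alg_aut (V : lmodType F) (m : V -> V -> V) (f : V -> V) : Prop :=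
  alg_hom m m f /\ bijective f.

Definition is_ideal (V : lmodType F) (m : V -> V -> V) (I : V -> Prop) : Prop :=
  I 0 /\ (forall (a : F) x y, I x -> I y -> I (a *: x + y)) /\
  (forall x y, I x -> I (m x y) /\ I (m y x)).

Definition proper_set (V : Type) (I : V -> Prop) : Prop := exists x, ~ I x.

Definition aut_invariant (V : lmodType F) (m : V -> V -> V) (I : V -> Prop) : Prop :=
  forall f, alg_aut m f -> forall x, I x <-> I (f x).

Definition is_subalgebra (V : lmodType F) (m : V -> V -> V) (S : V -> Prop) : Prop :=
  S 0 /\ (forall (a : F) x y, S x -> S y -> S (a *: x + y)) /\
  (forall x y, S x -> S y -> S (m x y)).

Definition generated_by2 (V : lmodType F) (m : V -> V -> V) (g0 g1 : V) : Prop :=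
  forall S : V -> Prop, is_subalgebra m S -> S g0 -> S g1 -> forall x, S x.

Definition symmetric_alg (V : lmodType F) (m : V -> V -> V) (g0 g1 : V) : Prop :=
  generated_by2 m g0 g1 /\
  exists f, [/\ alg_aut m f, (forall x, f (f x) = x), f g0 = g1 & f g1 = g0].

Definition is_basis (B : eqType) (V : lmodType F) (e : B -> V) : Prop :=
  (forall (s : seq B) (c : B -> F), uniq s ->
      \sum_(b <- s) c b *: e b = 0 -> forall b, b \in s -> c b = 0) /\
  (forall v : V, exists (s : seq B) (c : B -> F), v = \sum_(b <- s) c b *: e b).

(* basis index: a_i (i : int), s_{n+1} (n : nat), p_{1,3(n+1)} (true,n),
   p_{2,3(n+1)} (false,n) *)
Definition hidx := ((int + nat) + (bool * nat))%type.

Definition zbar (i : int) : 'Z_3 := i%:~R.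

Section HhatBasis.
Variables (V : lmodType F) (e : hidx -> V).
Definition hA (i : int) : V := e (inl (inl i)).
Definition hS (j : nat) : V := if j is j'.+1 then e (inl (inr j')) else 0.
Definition hP12 (b : bool) (k : nat) : V :=
  if (0 < k)%N && (3 %| k)%N then e (inr (b, (k %/ 3).-1)) else 0.
Definition hP (r : 'Z_3) (k : nat) : V :=
  if r == 1 then hP12 true k
  else if r == 2 then hP12 false k
  else - (hP12 true k + hP12 false k).
Definition hZ (r : 'Z_3) (k : nat) : V := hP (r + 1) k - hP (r - 1) k.
End HhatBasis.

Definition natdist (j l : nat) : nat := absz (j%:Z - l%:Z).

Definition is_Hhat (V : lmodType F) (m : V -> V -> V) (e : hidx -> V) : Prop :=
  let a := hA e in let s := hS e in let p := hP e in let z := hZ e in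
  [/\ comm_bilinear m, is_basis e &
   (forall i i' : int, m (a i) (a i') =
      2^-1 *: (a i + a i') + s (absz (i - i')) + z (zbar i) (absz (i - i'))) /\
   (forall (i : int) (j : nat), (0 < j)%N -> m (a i) (s j) =
      - ((3 / 4 : F) *: a i) + (3 / 8 : F) *: (a (i - j%:Z) + a (i + j%:Z))
      + (3 / 2 : F) *: s j - z (zbar i) j) /\
   (forall (i : int) (r : 'Z_3) (k : nat), (0 < k)%N -> (3 %| k)%N ->
      m (a i) (p r k) = (3 / 2 : F) *: p r k - p (- (zbar i + r)) k) /\
   (forall j l : nat, (0 < j)%N -> (0 < l)%N -> m (s j) (s l) =
      (3 / 4 : F) *: (s j + s l) - (3 / 8 : F) *: (s (natdist j l) + s (j + l)%N)) /\
   (forall (j k : nat) (r : 'Z_3), (0 < j)%N -> (0 < k)%N -> (3 %| k)%N ->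
      m (s j) (p r k) = (3 / 4 : F) *: (p r j + p r k)
                        - (3 / 8 : F) *: (p r (natdist j k) + p r (j + k)%N)) /\
   (forall (h k : nat) (r t : 'Z_3), (0 < h)%N -> (3 %| h)%N ->
      (0 < k)%N -> (3 %| k)%N ->
      m (p r h) (p t k) = (1 / 4 : F) *: (z (- (r + t)) h + z (- (r + t)) k)
          - (1 / 8 : F) *: (z (- (r + t)) (natdist h k) + z (- (r + t)) (h + k)%N))].

Definition widx := (int + nat)%type.

Section HBasis.
Variables (V : lmodType F) (e : widx -> V).
Definition wA (i : int) : V := e (inl i).
Definition wS (j : nat) : V := if j is j'.+1 then e (inr j') else 0.
End HBasis.

Definition is_Highwater (V : lmodType F) (m : V -> V -> V) (e : widx -> V) : Prop :=
  let a := wA e in let s := wS e in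
  [/\ comm_bilinear m, is_basis e,
   (forall i i' : int, m (a i) (a i') = 2^-1 *: (a i + a i') + s (absz (i - i'))),
   (forall (i : int) (j : nat), (0 < j)%N -> m (a i) (s j) =
      - ((3 / 4 : F) *: a i) + (3 / 8 : F) *: (a (i - j%:Z) + a (i + j%:Z))
      + (3 / 2 : F) *: s j) &
   (forall j l : nat, (0 < j)%N -> (0 < l)%N -> m (s j) (s l) =
      (3 / 4 : F) *: (s j + s l) - (3 / 8 : F) *: (s (natdist j l) + s (j + l)%N))].

Definition quotient_by (V Q : lmodType F) (m : V -> V -> V) (mQ : Q -> Q -> Q)
  (I : V -> Prop) (phi : V -> Q) : Prop :=
  [/\ alg_hom m mQ phi, (forall y, exists x, phi x = y) & (forall x, I x <-> phi x = 0)].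

End Algebras.

(* Main.v *)
(** Write Hhat = A + S + P with A, S, P spanned by the a_i, the s_j and the
    p_{r,k}, and let lambda be the weight: a_i |-> 1, s_j, p_{r,k} |-> 0.

    Ideals. For n in Z the reflection rho_n: a_i |-> a_{n-i}, s_j |-> s_j,
    p_r |-> - p_{n-r} is an automorphism. On ker lambda, rho_0 and rho_1 agree with
    fixed noncommutative polynomials, with coefficients in Z[1/6], in the
    multiplications by a_0, by a_1 and by s_1, so they preserve I meet ker lambda for
    every ideal I. If x in I has weight 1, then y = rho(x) x - x lies in I and has
    weight 0, hence rho(y) = x rho(x) - rho(x) is in I and so is rho(x). As
    rho_{n+1} = rho_1 rho_0 rho_n, all reflections preserve all ideals. Only the
    multiplication rules are used, so this covers the Highwater algebra (p = 0) too.

    Automorphisms. Identify A with Laurent polynomials in t, and S and P with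
    (pairs of) symmetric Laurent polynomials vanishing at 1. Comparing degrees shows
    that the nonzero idempotents are exactly the a_i. Hence an automorphism permutes
    the a_i; since a_i s_1 determines a_{i-1} + a_{i+1}, it acts on the indices by an
    affine map, of slope 1 or -1 by bijectivity. As a_0 and a_1 generate Hhat, the
    automorphism is a product of at most two reflections. *)

Require Import Defs.
From Stdlib Require Import BinNums ClassicalEpsilon.
From HB Require Import structures.
From mathcomp Require Import all_boot all_order all_algebra.
From mathcomp Require Import ring zify ssrZ.
Set Implicit Arguments. Unset Strict Implicit. Unset Printing Implicit Defensive.
Import Order.TTheory GRing.Theory Num.Theory.
Local Open Scope ring_scope.

(** * Linear extension from a basis *)

Definition spanning (F : fieldType) (B : Type) (V : lmodType F) (e : B -> V) : Prop :=
  forall v, exists (s : seq B) (c : B -> F), v = \sum_(b <- s) c b *: e b.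

Section BasisExtension.
Variables (F : fieldType) (B : eqType) (V W : lmodType F) (e : B -> V) (g : B -> W).

(** A vector may be presented by different lists, so the extension starts as a relation, shown
    afterwards to be a function. *)
Let graph (v : V) (w : W) := exists (s : seq B) (c : B -> F),
  v = \sum_(b <- s) c b *: e b /\ w = \sum_(b <- s) c b *: g b.

Lemma sum_scale_undup (M : lmodType F) (s : seq B) (c : B -> F) (h : B -> M) :
  \sum_(b <- s) c b *: h b = \sum_(b <- undup s) (c b *+ count_mem b s) *: h b.
Proof.
rewrite -big_undup_iterop_count; apply: eq_bigr => b _.
by rewrite -scalerMnl.
Qed.

(** Repeated entries become multiplicities and entries of [t] outside [s] get coefficient 0, so that
    two presentations can be compared over one duplicate-free list. *)
Lemma sum_scale_sub (M : lmodType F) (s t : seq B) (c : B -> F) (h : B -> M) :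
  uniq t -> {subset s <= t} ->
  \sum_(b <- s) c b *: h b = \sum_(b <- t) (c b *+ count_mem b s) *: h b.
Proof.
move=> ut st; rewrite sum_scale_undup.
rewrite [RHS](bigID (mem s) predT) /= [X in _ = _ + X]big1 ?addr0.
  rewrite -[RHS]big_filter; apply: perm_big; apply: uniq_perm => [||b].
  - exact: undup_uniq.
  - exact: filter_uniq.
  - by rewrite mem_filter mem_undup; case: (boolP (b \in s)) => //= /st ->.
by move=> b /count_memPn ->; rewrite mulr0n scale0r.
Qed.

(** Freeness makes [graph] single-valued, spanning makes it total. *)
Lemma basis_linear_ext : is_basis e -> exists f : {linear V -> W}, forall b, f (e b) = g b.
Proof.
move=> [hfree hspan].
have graphL a x x' y y' : graph x x' -> graph y y' -> graph (a *: x + y) (a *: x' + y').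
  move=> [s [c [-> ->]]] [t [d [-> ->]]].
  exists (undup (s ++ t)), (fun b => a * (c b *+ count_mem b s) + d b *+ count_mem b t).
  have u := undup_uniq (s ++ t).
  have ss : {subset s <= undup (s ++ t)} by move=> b; rewrite mem_undup mem_cat => ->.
  have st : {subset t <= undup (s ++ t)}.
    by move=> b; rewrite mem_undup mem_cat orbC => ->.
  rewrite !(sum_scale_sub _ _ u ss) !(sum_scale_sub _ _ u st) !scaler_sumr -!big_split /=.
  by split; apply: eq_bigr => b _; rewrite scalerDl scalerA.
have graph0 w : graph 0 w -> w = 0.
  move=> [s [c [h0 ->]]].
  have u := undup_uniq s; have ss : {subset s <= undup s} by move=> b; rewrite mem_undup.
  rewrite (sum_scale_sub _ _ u ss) big_seq big1 // => b hb.
  by rewrite (hfree _ (fun b => c b *+ count_mem b s) u _ _ hb) ?scale0r // -(sum_scale_sub _ _ u ss).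
have graph_fun v w w' : graph v w -> graph v w' -> w = w'.
  move=> h h'; apply/eqP; rewrite -subr_eq0; apply/eqP/graph0.
  by have := graphL (-1) _ _ _ _ h' h; rewrite !scaleN1r addNr addrC.
have graph_tot v : exists w, graph v w.
  by have [s [c ->]] := hspan v; eexists; exists s, c.
pose f v := proj1_sig (constructive_indefinite_description _ (graph_tot v)).
have fP v : graph v (f v) by rewrite /f; case: constructive_indefinite_description.
have fL : GRing.linear_for *:%R f.
  by move=> a x y; apply: (graph_fun _ _ _ (fP _)); apply: graphL; exact: fP.
pose fl : {linear V -> W} := HB.pack f (GRing.isLinear.Build F V W *:%R f fL).
exists fl => b; apply: (graph_fun _ _ _ (fP _)).
by exists [:: b], (fun=> 1); rewrite !big_seq1 !scale1r.
Qed.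

End BasisExtension.

(** * Linear identities and defining relations *)

Section LinearIdentities.
Variables (F : fieldType) (V : lmodType F).

Inductive vexp :=
  | VZero | VAtom of nat | VAdd of vexp & vexp | VOpp of vexp | VScale of F & vexp.

Fixpoint veval (env : seq V) (x : vexp) : V :=
  match x with
  | VZero => 0
  | VAtom n => nth 0 env n
  | VAdd x y => veval env x + veval env y
  | VOpp x => - veval env x
  | VScale a x => a *: veval env x
  end.

Fixpoint vcoef (n : nat) (x : vexp) : F :=
  match x with
  | VZero => 0
  | VAtom k => if k == n then 1 else 0
  | VAdd x y => vcoef n x + vcoef n y
  | VOpp x => - vcoef n x
  | VScale a x => a * vcoef n x
  end.

(** Recursion on [n] instead of a quantifier, so that it unfolds into one scalar equation per
    atom. *)
Fixpoint vcoef_eq (n : nat) (x y : vexp) : Prop :=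
  if n is k.+1 then vcoef k x = vcoef k y /\ vcoef_eq k x y else True.

Lemma vevalE env x : veval env x = \sum_(i < size env) vcoef i x *: nth 0 env i.
Proof.
elim: x => [|n|x IHx y IHy|x IHx|a x IHx] /=; rewrite ?IHx ?IHy.
- by rewrite big1 // => i _; rewrite scale0r.
- case: (ltnP n (size env)) => hn; last first.
    rewrite nth_default // big1 // => i _.
    by case: eqP => [E|_]; [move: (ltn_ord i); rewrite -E ltnNge hn | rewrite scale0r].
  rewrite (bigD1 (Ordinal hn)) //= eqxx scale1r big1 ?addr0 // => i hi.
  by rewrite eq_sym -val_eqE in hi; rewrite (negPf hi) scale0r.
- by rewrite -big_split; apply: eq_bigr => i _; rewrite scalerDl.
- by rewrite -sumrN; apply: eq_bigr => i _; rewrite scaleNr.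
- by rewrite scaler_sumr; apply: eq_bigr => i _; rewrite scalerA.
Qed.

Lemma veval_eq env x y : vcoef_eq (size env) x y -> veval env x = veval env y.
Proof.
move=> h; rewrite !vevalE; apply: eq_bigr => -[i hi] _ /=; congr (_ *: _).
elim: (size env) h i hi => [|n IH] //= [h0 h] i.
by rewrite ltnS leq_eqVlt => /orP[/eqP -> //|]; apply: IH.
Qed.
End LinearIdentities.

(* Atoms are compared up to conversion: the same operation may be reached through
   different paths of the algebraic hierarchy. *)
Ltac lm_same x y := match goal with _ => unify x y end.
Ltac lm_add x env :=
  lazymatch env with
  | nil => constr:(cons x nil)
  | cons ?y ?l =>
      match constr:(Set) with
      | _ => let _ := lm_same x y in env
      | _ => let l' := lm_add x l in constr:(cons y l')
      end
  end.
Ltac lm_atoms t env :=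
  lazymatch t with
  | @GRing.zero _ => env
  | (?a + ?b)%R => let env := lm_atoms a env in lm_atoms b env
  | (- ?a)%R => lm_atoms a env
  | (_ *: ?a)%R => lm_atoms a env
  | _ => lm_add t env
  end.
Ltac lm_index x env :=
  lazymatch env with
  | cons ?y ?l =>
      match constr:(Set) with
      | _ => let _ := lm_same x y in constr:(O)
      | _ => let n := lm_index x l in constr:(S n)
      end
  end.
Ltac lm_reify F t env :=
  lazymatch t with
  | @GRing.zero _ => constr:(@VZero F)
  | (?a + ?b)%R =>
      let x := lm_reify F a env in let y := lm_reify F b env in constr:(@VAdd F x y)
  | (- ?a)%R => let x := lm_reify F a env in constr:(@VOpp F x)
  | (?c *: ?a)%R => let x := lm_reify F a env in constr:(@VScale F c x)
  | _ => let n := lm_index t env in constr:(@VAtom F n)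
  end.
(* Reduces an equation between linear combinations in an [F]-module to the
   equations between the coefficients of each atom. *)
Ltac lmod_coefs F V :=
  lazymatch goal with
  | |- ?l = ?r =>
      let env := lm_atoms l (@nil V) in
      let env := lm_atoms r env in
      let x := lm_reify F l env in
      let y := lm_reify F r env in
      change (veval env x = veval env y); apply: veval_eq; cbn [vcoef_eq vcoef size eqn eq_op];
      repeat (split; [ simpl | ]); [ .. | exact: I ]
  end.


Section Relations.
Variables (F : fieldType) (V : lmodType F) (m : V -> V -> V) (e : hidx -> V).

Definition sI (j : int) : V := hS e `|j|.
Definition pI (r : 'Z_3) (k : int) : V := hP e r `|k|.
Definition zI (r : 'Z_3) (k : int) : V := pI (r + 1) k - pI (r - 1) k.

(* The relations (H1)-(H6) with the indices of s and p ranging over all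
   integers, through s_{-j} = s_j and p_{r,-k} = p_{r,k}. They are shared by
   Hhat and, with all p equal to 0, by the Highwater algebra. *)
Record cover_rels : Prop := CoverRels {
  rels_bil : comm_bilinear m;
  rels_span : spanning e;
  rels_aa : forall i j : int, m (hA e i) (hA e j) =
     2^-1 *: (hA e i + hA e j) + sI (i - j) + zI (zbar i) (i - j);
  rels_as : forall i j : int, m (hA e i) (sI j) =
     - ((3 / 4 : F) *: hA e i) + (3 / 8 : F) *: (hA e (i - j) + hA e (i + j))
     + (3 / 2 : F) *: sI j - zI (zbar i) j;
  rels_ap : forall (i : int) (r : 'Z_3) (k : int), m (hA e i) (pI r k) =
     (3 / 2 : F) *: pI r k - pI (- (zbar i + r)) k;
  rels_ss : forall j l : int, m (sI j) (sI l) =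
     (3 / 4 : F) *: (sI j + sI l) - (3 / 8 : F) *: (sI (j - l) + sI (j + l));
  rels_sp : forall (j k : int) (r : 'Z_3), (3 %| k)%Z -> m (sI j) (pI r k) =
     (3 / 4 : F) *: (pI r j + pI r k) - (3 / 8 : F) *: (pI r (j - k) + pI r (j + k));
  rels_pp : forall (h k : int) (r t : 'Z_3), (3 %| h)%Z -> (3 %| k)%Z ->
     m (pI r h) (pI t k) = (1 / 4 : F) *: (zI (- (r + t)) h + zI (- (r + t)) k)
       - (1 / 8 : F) *: (zI (- (r + t)) (h - k) + zI (- (r + t)) (h + k)) }.

Lemma sIN j : sI (- j) = sI j. Proof. by rewrite /sI abszN. Qed.
Lemma sI0 : sI 0 = 0. Proof. by []. Qed.
Lemma pIN r k : pI r (- k) = pI r k. Proof. by rewrite /pI abszN. Qed.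
Lemma zIN r k : zI r (- k) = zI r k. Proof. by rewrite /zI !pIN. Qed.

Lemma pI_eq0 r k : ~~ (3 %| k)%Z || (k == 0) -> pI r k = 0.
Proof.
move=> h; rewrite /pI /hP /hP12.
have -> : (0 < `|k|)%N && (3 %| `|k|)%N = false.
  by move: h; rewrite dvdzE absz_gt0 /=; case: (k == 0); rewrite ?orbT ?orbF //= => /negPf.
by rewrite addr0 oppr0; case: ifP => // _; case: ifP.
Qed.

Lemma pI0 r : pI r 0 = 0. Proof. by rewrite pI_eq0 ?eqxx ?orbT. Qed.
Lemma zI0 r : zI r 0 = 0. Proof. by rewrite /zI !pI0 subr0. Qed.

Lemma zI_eq0 r k : ~~ (3 %| k)%Z || (k == 0) -> zI r k = 0.
Proof. by move=> h; rewrite /zI !pI_eq0 ?subr0. Qed.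

Lemma pI_res0 k : pI 0 k = - (pI 1 k + pI 2 k).
Proof. by []. Qed.

End Relations.

Lemma Z3_cases (r : 'Z_3) : [\/ r = 0, r = 1 | r = 2].
Proof.
case: r => -[|[|[|//]]] h; [apply: Or31|apply: Or32|apply: Or33]; exact: val_inj.
Qed.

(** For relations that survive a change of sign of an index: every integer is plus or minus a
    natural number. *)
Lemma int_sym (P : int -> int -> Prop) :
  (forall j k : nat, P j k) -> (forall j k, P j k -> P (- j) k) ->
  (forall j k, P j k -> P j (- k)) -> forall j k, P j k.
Proof.
move=> h hl hr j k.
have h' (j' : nat) k' : P j' k'.
  by case: (intP k') => [|n|n]; [exact: h | exact: h | apply/hr/h].
by case: (intP j) => [|n|n]; [exact: h' | exact: h' | apply/hl/h'].
Qed.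

Lemma int_sym1 (P : int -> Prop) :
  (forall j : nat, P j) -> (forall j, P j -> P (- j)) -> forall j, P j.
Proof. by move=> h hN j; case: (intP j) => [|n|n]; [exact: h| exact: h|apply/hN/h]. Qed.

(** * Both algebras satisfy the integer-indexed relations *)

Section CoverInstances.
Variables (F : fieldType) (V : lmodType F) (m : V -> V -> V).
Hypothesis hF2 : (2%:R : F) != 0.

Lemma nz4 : (4%:R : F) != 0.
Proof. by rewrite (natrM F 2 2) mulf_neq0. Qed.
Lemma nz8 : (8%:R : F) != 0.
Proof. by rewrite (natrM F 2 4) mulf_neq0 // nz4. Qed.

Section Bil.
Hypothesis hm : comm_bilinear m.
Lemma bilC x y : m x y = m y x. Proof. by case: hm => h _; exact: h. Qed.
Lemma bilP a x y z : m (a *: x + y) z = a *: m x z + m y z.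
Proof. by case: hm => _ h; exact: h. Qed.
Lemma bilDl x y z : m (x + y) z = m x z + m y z.
Proof. by rewrite -[x]scale1r bilP !scale1r. Qed.
Lemma bil0l z : m 0 z = 0.
Proof. by apply: (addrI (m 0 z)); rewrite -bilDl !addr0. Qed.
Lemma bilZl a x z : m (a *: x) z = a *: m x z.
Proof. by rewrite -[a *: x]addr0 bilP bil0l addr0. Qed.
Lemma bilNl x z : m (- x) z = - m x z.
Proof. by rewrite -scaleN1r bilZl scaleN1r. Qed.
Lemma bilDr x y z : m x (y + z) = m x y + m x z.
Proof. by rewrite bilC bilDl !(bilC _ x). Qed.
Lemma bilZr a x z : m x (a *: z) = a *: m x z.
Proof. by rewrite bilC bilZl bilC. Qed.
Lemma bilNr x z : m x (- z) = - m x z.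
Proof. by rewrite bilC bilNl bilC. Qed.
Lemma bil0r x : m x 0 = 0. Proof. by rewrite bilC bil0l. Qed.
End Bil.

(** A change of sign of an index of s or p only permutes terms on the right of (H2)-(H6), and at
    index 0 the right-hand sides vanish, for instance because 3/8 + 3/8 = 3/4 in (H2). *)
Lemma Hhat_rels (e : hidx -> V) : is_Hhat m e -> cover_rels m e.
Proof.
case=> hm [_ hspan] [haa [has [hap [hss [hsp hpp]]]]].
split=> //.
- move=> i j; elim/int_sym1: j => [j|j IH]; last first.
    by rewrite sIN IH zIN opprK [hA _ (i - j) + _]addrC.
  case: j => [|j]; last exact: has.
  rewrite sI0 (bil0r hm) zI0 !addr0 !subr0 scaler0 !addr0.
  by lmod_coefs F V; field; rewrite nz4 nz8.
- move=> i r k; elim/int_sym1: k => [k|k IH]; last by rewrite !pIN.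
  case: (posnP k) => [->|k0]; first by rewrite !pI0 (bil0r hm) scaler0 subr0.
  case: (boolP (3 %| k)%N) => hk; first exact: hap.
  by rewrite !pI_eq0 ?dvdzE ?hk // (bil0r hm) scaler0 subr0.
- apply: int_sym => [j l|j k IH|j k IH]; last 2 first.
  + by rewrite sIN -opprD sIN [- j + k]addrC -[k - j]opprB sIN IH [sI _ (j - k) + _]addrC.
  + by rewrite sIN opprK IH [sI _ (j - k) + _]addrC.
  case: j => [|j]; last case: l => [|l]; last exact: hss.
  + rewrite sI0 (bil0l hm) sub0r sIN !add0r.
    by lmod_coefs F V; field; rewrite nz4 nz8.
  + rewrite sI0 (bil0r hm) subr0 !addr0.
    by lmod_coefs F V; field; rewrite nz4 nz8.
- move=> j k r; move: j k; apply: int_sym => [j k|j k IH|j k IH] hk; last 2 first.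
  + by rewrite sIN -opprD !pIN [- j + k]addrC -[k - j]opprB pIN IH // [pI _ r (j - k) + _]addrC.
  + by rewrite pIN opprK IH ?[pI _ r (j - k) + _]addrC //; move: hk; rewrite !dvdzE abszN.
  case: j => [|j]; last case: k hk => [|k] hk; last exact: hsp.
  + rewrite sI0 (bil0l hm) sub0r pIN !add0r pI0.
    by lmod_coefs F V; field; rewrite nz4 nz8.
  + rewrite pI0 (bil0r hm) subr0 !addr0.
    by lmod_coefs F V; field; rewrite nz4 nz8.
- move=> h k r t; move: h k; apply: int_sym => [j k|j k IH|j k IH] hj hk; last 2 first.
  + rewrite dvdzE abszN -dvdzE in hj.
    by rewrite pIN -opprD !zIN [- j + k]addrC -[k - j]opprB zIN IH // [zI _ _ (j - k) + _]addrC.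
  + rewrite dvdzE abszN -dvdzE in hk.
    by rewrite pIN zIN opprK IH // [zI _ _ (j - k) + _]addrC.
  case: j hj => [|j] hj; last case: k hk => [|k] hk; last exact: hpp.
  + rewrite pI0 (bil0l hm) sub0r zIN !add0r zI0.
    by lmod_coefs F V; field; rewrite nz4 nz8.
  + rewrite pI0 (bil0r hm) subr0 zI0 ?addr0.
    by lmod_coefs F V; field; rewrite nz4 nz8.
Qed.

(** The index set of Hhat is kept and every p is sent to 0. Such a family is not free, hence
    [cover_rels] asks only for [spanning]. *)
Definition widx_ext (e : widx -> V) (b : hidx) : V := if b is inl w then e w else 0.

Lemma pI_widx e r k : pI (widx_ext e) r k = 0.
Proof.
rewrite /pI /hP /hP12 /=; do ! case: ifP => _ //; by rewrite addr0 oppr0.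
Qed.

Lemma zI_widx e r k : zI (widx_ext e) r k = 0.
Proof. by rewrite /zI !pI_widx subr0. Qed.

Lemma Highwater_rels (e : widx -> V) : is_Highwater m e -> cover_rels m (widx_ext e).
Proof.
case=> hm [_ hspan] haa has hss.
split=> //; rewrite /hA /=.
- move=> v; have [s [c ->]] := hspan v.
  exists (map inl s), (fun b => if b is inl w then c w else 0).
  by rewrite big_map.
- by move=> i j; rewrite zI_widx addr0; exact: haa.
- move=> i j; rewrite zI_widx subr0; elim/int_sym1: j => [j|j IH]; last first.
    by rewrite sIN IH opprK [e (inl (i - j)) + _]addrC.
  case: j => [|j]; last exact: (has i j.+1 isT).
  rewrite sI0 (bil0r hm) !addr0 ?subr0 scaler0 !addr0.
  by lmod_coefs F V; field; rewrite nz4 nz8.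
- by move=> i r k; rewrite !pI_widx (bil0r hm) scaler0 subr0.
- apply: int_sym => [j l|j k IH|j k IH]; last 2 first.
  + by rewrite sIN -opprD sIN [- j + k]addrC -[k - j]opprB sIN IH [sI _ (j - k) + _]addrC.
  + by rewrite sIN opprK IH [sI _ (j - k) + _]addrC.
  case: j => [|j]; last case: l => [|l]; last exact: (hss j.+1 l.+1 isT isT).
  + rewrite sI0 (bil0l hm) sub0r sIN !add0r.
    by lmod_coefs F V; field; rewrite nz4 nz8.
  + rewrite sI0 (bil0r hm) subr0 !addr0.
    by lmod_coefs F V; field; rewrite nz4 nz8.
- by move=> j k r _; rewrite !pI_widx (bil0r hm) !addr0 !scaler0 subr0.
- by move=> h k r t _ _; rewrite !pI_widx !zI_widx (bil0r hm) !addr0 !scaler0 subr0.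
Qed.

End CoverInstances.

(** * A computational check of operator identities *)

(* Formal combinations of basis vectors whose index is [3 n v + c] for a fixed
   but arbitrary integer [v]: every basis vector of Hhat is one of [SA 1 c],
   [SS 1 c], [SP r 1 0] for [c, r] in a finite set, so that an identity between
   linear operators can be checked by computation. Products are scaled by 8 to
   keep the coefficients integral. *)
Inductive satom := SA of int & int | SS of int & int | SP of int & int & int.

Definition satom_eqb (x y : satom) : bool :=
  match x, y with
  | SA n c, SA n' c' => (n == n') && (c == c')
  | SS n c, SS n' c' => (n == n') && (c == c')
  | SP r n c, SP r' n' c' => [&& r == r', n == n' & c == c']
  | _, _ => false
  end.

Lemma satom_eqbP x y : satom_eqb x y -> x = y.
Proof.
case: x y => [n c|n c|r n c] [n' c'|n' c'|r' n' c'] //=.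
- by case/andP=> /eqP-> /eqP->.
- by case/andP=> /eqP-> /eqP->.
- by case/and3P=> /eqP-> /eqP-> /eqP->.
Qed.

Definition slin := seq (Z * satom).

Definition szero (n c : int) : bool := (n == 0) && (c == 0).
(** A formal choice of one index from each pair x, -x. It may differ from the sign of 3 n v + c;
    since s and p are even in their index, any choice is sound. *)
Definition sneg (n c : int) : bool := (n < 0) || (n == 0) && (c < 0).
Definition sabs (n c : int) : int * int := if sneg n c then (- n, - c) else (n, c).

(** Only simplifications valid for every v are made: whether 3 divides 3 n v + c depends on c
    alone. *)
Definition snorm1 (t : Z * satom) : slin :=
  let: (z, x) := t in
  match x with
  | SA _ _ => [:: t]
  | SS n c => if szero n c then [::] else
              let: (n', c') := sabs n c in [:: (z, SS n' c')]
  | SP r n c => if ~~ (3 %| c)%Z || szero n c then [::] else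
              let: (n', c') := sabs n c in
              let r' := (r %% 3)%Z in
              if r' == 0 then [:: (- z, SP 1 n' c'); (- z, SP 2 n' c')]
              else [:: (z, SP r' n' c')]
  end.

Fixpoint sins (t : Z * satom) (l : slin) : slin :=
  if l is u :: l' then
    if satom_eqb t.2 u.2 then (t.1 + u.1, t.2) :: l' else u :: sins t l'
  else [:: t].

Definition snorm (l : slin) : slin :=
  foldr (fun t acc => foldr sins acc (snorm1 t)) [::] l.

Definition sscale (z : Z) (l : slin) : slin := [seq (z * t.1, t.2) | t <- l].

Definition snull (l : slin) : bool := all (fun t => t.1 == 0) (snorm l).

(** [GA i] stands for a_i with i independent of v, and [GS] for s_1, so one word acts on all basis
    vectors. *)
Inductive sgen := GA of int | GS.

Definition szlin (z : Z) (r n c : int) : slin :=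
  [:: (z, SP (r + 1) n c); (- z, SP (r - 1) n c)].

(** In [GS] times [SP] a single term of (H5) survives: if 3 divides k, it divides none of 1, k - 1,
    k + 1. Likewise [GS] times [SA] has no z-term, as z_{r,1} = 0. *)
Definition smul1 (g : sgen) (x : satom) : slin :=
  match g, x with
  | GA i, SA n c =>
      [:: (4, SA 0 i); (4, SA n c); (8, SS n (c - i))] ++ szlin 8 i n (c - i)
  | GA i, SS n c =>
      [:: (- 6, SA 0 i); (3, SA (- n) (i - c)); (3, SA n (i + c)); (12, SS n c)]
        ++ szlin (- 8) i n c
  | GA i, SP r n c => [:: (12, SP r n c); (- 8, SP (- (i + r)) n c)]
  | GS, SA n c =>
      [:: (- 6, SA n c); (3, SA n (c - 1)); (3, SA n (c + 1)); (12, SS 0 1)]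
  | GS, SS n c =>
      [:: (6, SS n c); (6, SS 0 1); (- 3, SS n (c - 1)); (- 3, SS n (c + 1))]
  | GS, SP r n c => if (3 %| c)%Z then [:: (6, SP r n c)] else [::]
  end.

Definition smul (g : sgen) (l : slin) : slin :=
  snorm (flatten [seq sscale t.1 (smul1 g t.2) | t <- l]).

Definition sword := (Z * seq sgen)%type.

(* Words have length at most 3, and all are scaled by [8 ^+ 3]. *)
Definition sact (W : seq sword) (l : slin) : slin :=
  flatten [seq sscale (w.1 * 8 ^+ (3 - size w.2)) (foldr smul l w.2) | w <- W].

Definition srefl (n0 : int) (l : slin) : slin :=
  [seq match t.2 with
       | SA n c => (t.1, SA (- n) (n0 - c))
       | SS n c => t
       | SP r n c => (- t.1, SP (n0 - r) n c)
       end | t <- l].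

Definition sweight (x : satom) : Z := if x is SA _ _ then 1 else 0.

Definition srefl_defect (W : seq sword) (N : Z) (n0 : int) (l : slin) : slin :=
  sact W l ++ sscale (- (N * 8 ^+ 3)) (srefl n0 l).

(** The word need only act as N rho on vectors of weight 0. So its defect D is required to satisfy
    D(x) = weight(x) D(a_0), which leaves D(a_0) free. *)
Definition srefl_check (W : seq sword) (N : Z) (n0 : int) (x : satom) : bool :=
  snull (srefl_defect W N n0 [:: (1, x)]
         ++ sscale (- sweight x) (srefl_defect W N n0 [:: (1, SA 0 0)])).

Definition basis_satoms : seq satom :=
  [:: SA 1 0; SA 1 1; SA 1 2; SS 1 0; SS 1 1; SS 1 2; SP 1 1 0; SP 2 1 0].

(* This is - 4 L (L - 2) (L - 5/2) + 3 for L = multiplication by a_0: since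
   L (L - 1) (L - 2) (L - 5/2) vanishes on the vectors fixed by rho_0 and
   rho_0 = -1 on the 1/2-eigenspace, it is 3 rho_0 up to a multiple of the weight. *)
Definition refl0_words : seq sword :=
  let a := GA 0 in
  [:: (- 4, [:: a; a; a]); (18, [:: a; a]); (- 20, [:: a]); (3, [::])].

(* The coefficients were obtained by solving a linear system; only the primes 2 and 3
   occur in their denominators. *)
Definition refl1_words : seq sword :=
  let p := GA 0 in let q := GA 1 in let s := GS in
  [:: (- 24, [:: p; p; p]); (- 24, [:: q; q; q]);
      (- 12, [:: q; p; q]); (- 12, [:: p; q; p]); (- 12, [:: p; q; q]); (- 12, [:: q; p; p]);
      (- 6, [:: q; q; s]); (- 6, [:: p; p; s]); (- 12, [:: q; p; s]); (- 12, [:: p; q; s]);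
      (- 12, [:: p; s; q]); (- 12, [:: q; s; p]); (- 6, [:: p; s; p]); (- 6, [:: q; s; q]);
      (- 32, [:: s; q; p]); (- 32, [:: s; p; q]); (- 48, [:: s; s; p]); (- 48, [:: s; p; s]);
      (108, [:: p; p]); (108, [:: q; q]); (60, [:: p; q]); (60, [:: q; p]);
      (73, [:: s; q]); (51, [:: q; s]); (109, [:: s; p]); (87, [:: p; s]); (80, [:: s; s]);
      (- 144, [:: p]); (- 144, [:: q]); (- 126, [:: s]); (36, [::])].

Lemma refl0_check : all (srefl_check refl0_words 3 0) basis_satoms.
Proof. by vm_compute. Qed.

Lemma refl1_check : all (srefl_check refl1_words 36 1) basis_satoms.
Proof. by vm_compute. Qed.

(** * Soundness of the computational check *)

Section Soundness.
Variables (F : fieldType) (V : lmodType F) (m : V -> V -> V) (e : hidx -> V).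
Hypothesis hF2 : (2%:R : F) != 0.
Hypothesis hr : cover_rels m e.
Variable v : int.

Let hm := rels_bil hr.
Let nz4 := nz4 hF2.
Let nz8 := nz8 hF2.

Definition sidx (n c : int) : int := 3 * n * v + c.

Lemma sidx0 c : sidx 0 c = c. Proof. by rewrite /sidx mulr0 mul0r add0r. Qed.
Lemma sidxDr n c d : sidx n (c + d) = sidx n c + d. Proof. exact: addrA. Qed.

Definition aeval (x : satom) : V :=
  match x with
  | SA n c => hA e (sidx n c)
  | SS n c => sI e (sidx n c)
  | SP r n c => pI e (zbar r) (sidx n c)
  end.

(** Coefficients are binary integers for the sake of [vm_compute]; this is their image under the
    ring morphisms [Z] to [int] to F. *)
Definition zF (z : Z) : F := (int_of_Z z)%:~R.

Lemma zFD x y : zF (x + y) = zF x + zF y. Proof. by rewrite /zF !rmorphD. Qed.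
Lemma zFN x : zF (- x) = - zF x. Proof. by rewrite /zF !rmorphN. Qed.
Lemma zFM x y : zF (x * y) = zF x * zF y. Proof. by rewrite /zF !rmorphM. Qed.
Lemma zFn n : zF n%:R = n%:R. Proof. by rewrite /zF !rmorph_nat. Qed.
Lemma zF0 : zF 0 = 0. Proof. by []. Qed.
Lemma zFX x n : zF (x ^+ n) = zF x ^+ n. Proof. by rewrite /zF !rmorphXn. Qed.

Definition leval (l : slin) : V := \sum_(t <- l) zF t.1 *: aeval t.2.

Lemma leval_nil : leval [::] = 0. Proof. exact: big_nil. Qed.
Lemma leval_cons t l : leval (t :: l) = zF t.1 *: aeval t.2 + leval l.
Proof. exact: big_cons. Qed.
Lemma leval_cat l l' : leval (l ++ l') = leval l + leval l'.
Proof. exact: big_cat. Qed.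
Lemma leval_scale z l : leval (sscale z l) = zF z *: leval l.
Proof.
rewrite /leval big_map scaler_sumr; apply: eq_bigr => t _ /=.
by rewrite zFM scalerA.
Qed.
Lemma leval_flatten (T : Type) (h : T -> slin) (s : seq T) :
  leval (flatten [seq h t | t <- s]) = \sum_(t <- s) leval (h t).
Proof.
elim: s => [|t s IH] /=; first by rewrite big_nil leval_nil.
by rewrite leval_cat IH big_cons.
Qed.

Lemma leval_ins t l : leval (sins t l) = leval (t :: l).
Proof.
elim: l => [|u l IH] //=; case: ifP => [/satom_eqbP E|_]; rewrite !leval_cons /=.
  by rewrite zFD scalerDl -addrA E.
by rewrite IH leval_cons addrCA.
Qed.

Lemma dvd3_sidx n c : (3 %| sidx n c)%Z = (3 %| c)%Z.
Proof. by rewrite /sidx; lia. Qed.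

Lemma sidxN n c : sidx (- n) (- c) = - sidx n c.
Proof. by rewrite /sidx opprD; ring. Qed.

Lemma zbar3 k : zbar (3 * k) = 0.
Proof.
have E : (3 : int)%:~R = 0 :> 'Z_3 by apply: val_inj.
by rewrite /zbar intrM E mul0r.
Qed.

Lemma zbarD i j : zbar (i + j) = zbar i + zbar j. Proof. exact: intrD. Qed.
Lemma zbarN i : zbar (- i) = - zbar i. Proof. exact: intrN. Qed.
Lemma zbar0 : zbar 0 = 0. Proof. by []. Qed.
Lemma zbar1 : zbar 1 = 1. Proof. by []. Qed.
Lemma zbar2 : zbar 2 = 2. Proof. exact: val_inj. Qed.

Lemma zbarD1 r : zbar (r + 1) = zbar r + 1. Proof. exact: zbarD. Qed.
Lemma zbarB1 r : zbar (r - 1) = zbar r - 1. Proof. by rewrite zbarD zbarN. Qed.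

Lemma zbar_mod r : zbar r = zbar (r %% 3)%Z.
Proof. by rewrite {1}(divz_eq r 3) zbarD mulrC zbar3 add0r. Qed.

Lemma leval_norm1 t : leval (snorm1 t) = leval [:: t].
Proof.
case: t => z [n c|n c|r n c] //=.
  case: ifP => [/andP[/eqP-> /eqP->]|_].
    by rewrite leval_nil leval_cons leval_nil /= /sidx mulr0 mul0r scaler0 addr0.
  rewrite /sabs; case: ifP => _ //.
  by rewrite !leval_cons /= sidxN sIN.
case: ifP => [h|_].
  rewrite leval_nil leval_cons leval_nil /= pI_eq0 ?scaler0 ?addr0 //.
  rewrite dvd3_sidx; case/orP: h => [->//|/andP[/eqP-> /eqP->]].
  by rewrite /sidx mulr0 mul0r eqxx orbT.
have -> : (let: (n', c') := sabs n c in
    if (r %% 3)%Z == 0 then [:: (- z, SP 1 n' c'); (- z, SP 2 n' c')]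
    else [:: (z, SP (r %% 3)%Z n' c')]) =
  if (r %% 3)%Z == 0 then [:: (- z, SP 1 (sabs n c).1 (sabs n c).2); (- z, SP 2 (sabs n c).1 (sabs n c).2)]
    else [:: (z, SP (r %% 3)%Z (sabs n c).1 (sabs n c).2)].
  by case: (sabs n c).
have E r' : pI e r' (sidx (sabs n c).1 (sabs n c).2) = pI e r' (sidx n c).
  by rewrite /sabs; case: ifP => _ //=; rewrite sidxN pIN.
case: ifP => [/eqP h|h]; rewrite !leval_cons !leval_nil /= !E (zbar_mod r) ?h //.
by rewrite zFN zbar0 zbar1 zbar2 pI_res0; lmod_coefs F V; ring.
Qed.

Lemma leval_norm l : leval (snorm l) = leval l.
Proof.
elim: l => [|t l IH] //=; rewrite -/(snorm l) in IH *.
have -> acc : leval (foldr sins acc (snorm1 t)) = leval (snorm1 t) + leval acc.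
  elim: (snorm1 t) => [|u s IHs] /=; first by rewrite leval_nil add0r.
  by rewrite leval_ins !leval_cons IHs addrA.
by rewrite leval_norm1 IH !leval_cons leval_nil addr0.
Qed.

(** Formal cancellation suffices for every v, even where distinct atoms happen to have the same
    value. *)
Lemma leval_null l : snull l -> leval l = 0.
Proof.
rewrite -(leval_norm l) /snull; elim: (snorm l) => [|t s IH] /=; first by rewrite leval_nil.
by case/andP=> /eqP h /IH; rewrite leval_cons h zF0 scale0r add0r.
Qed.

Definition sgen_val (g : sgen) : V := if g is GA i then hA e i else sI e 1.

Lemma leval_szlin z r n c : leval (szlin z r n c) = zF z *: zI e (zbar r) (sidx n c).
Proof.
rewrite !leval_cons leval_nil /= zFN /zI zbarD1 zbarB1.
by lmod_coefs F V; ring.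
Qed.

Lemma smul1P g x : leval (smul1 g x) = (8%:R : F) *: m (sgen_val g) (aeval x).
Proof.
case: g => [i|]; case: x => [n c|n c|r n c]; rewrite /smul1 /sgen_val /aeval ?leval_cat ?leval_szlin.
- rewrite (rels_aa hr) !leval_cons leval_nil /=.
  rewrite -[i - _]opprB sIN zIN.
  rewrite -sidxDr.
  rewrite sidx0.
  by rewrite !zFn; lmod_coefs F V; field; rewrite ?hF2.
- rewrite (rels_as hr) !leval_cons leval_nil /=.
  rewrite sidx0.
  rewrite (_ : sidx (- n) (i - c) = i - sidx n c); last by rewrite /sidx; ring.
  rewrite (_ : sidx n (i + c) = i + sidx n c); last by rewrite /sidx; ring.
  by rewrite !(zFN, zFn); lmod_coefs F V; field; rewrite ?hF2 ?nz4 ?nz8.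
- rewrite (rels_ap hr) !leval_cons leval_nil /= !zbarN !zbarD.
  by rewrite !(zFN, zFn); lmod_coefs F V; field; rewrite ?hF2.
- rewrite (bilC hm) (rels_as hr) !leval_cons leval_nil /= (@zI_eq0 _ _ e _ 1) //.
  rewrite sidx0.
  rewrite !sidxDr.
  by rewrite !(zFN, zFn); lmod_coefs F V; field; rewrite ?hF2 ?nz4 ?nz8.
- rewrite (bilC hm) (rels_ss hr) !leval_cons leval_nil /=.
  rewrite sidx0.
  rewrite !sidxDr.
  by rewrite !(zFN, zFn); lmod_coefs F V; field; rewrite ?hF2 ?nz4 ?nz8.
- case: ifP => h; last by rewrite leval_nil pI_eq0 ?dvd3_sidx ?h // (bil0r hm) scaler0.
  rewrite (rels_sp hr) ?dvd3_sidx // !leval_cons leval_nil /=.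
  have h1 : (3 %| 1 - sidx n c)%Z = false by rewrite /sidx; lia.
  have h2 : (3 %| 1 + sidx n c)%Z = false by rewrite /sidx; lia.
  rewrite (@pI_eq0 _ _ e _ 1) // (@pI_eq0 _ _ e _ (1 - _)) ?h1 // (@pI_eq0 _ _ e _ (1 + sidx n c)) ?h2 //.
  by rewrite zFn; lmod_coefs F V; field; rewrite ?hF2 ?nz4 ?nz8.
Qed.

Definition sop (g : sgen) (x : V) : V := (8%:R : F) *: m (sgen_val g) x.

Lemma smulP g l : leval (smul g l) = sop g (leval l).
Proof.
rewrite /smul leval_norm leval_flatten /sop.
elim: l => [|t l IH]; first by rewrite big_nil leval_nil (bil0r hm) scaler0.
rewrite big_cons IH leval_cons leval_scale smul1P (bilDr hm) (bilZr hm) scalerDr.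
by congr (_ + _); rewrite !scalerA mulrC.
Qed.

Definition vact (W : seq sword) (x : V) : V :=
  \sum_(w <- W) zF (w.1 * 8 ^+ (3 - size w.2)) *: foldr sop x w.2.

Lemma sactP W l : leval (sact W l) = vact W (leval l).
Proof.
rewrite /sact leval_flatten; apply: eq_bigr => w _; rewrite leval_scale.
by congr (_ *: _); elim: w.2 => //= g s <-; rewrite smulP.
Qed.

End Soundness.

(** * Weight and reflections *)

Section Spanning.
Variables (F : fieldType) (V : lmodType F) (e : hidx -> V).

Lemma span_ind (P : V -> Prop) : spanning e -> P 0 ->
  (forall (a : F) x y, P x -> P y -> P (a *: x + y)) ->
  (forall b, P (e b)) -> forall x, P x.
Proof.
move=> hs h0 hL he x; have [s [c ->]] := hs x.
by elim: s => [|b s IH]; rewrite ?big_nil // big_cons; apply: hL.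
Qed.

Lemma e_cases b : [\/ exists i, e b = hA e i, exists j, e b = sI e j |
  exists (r k : int), [/\ e b = pI e (zbar r) k, (3 %| k)%Z & r = 1 \/ r = 2]].
Proof.
case: b => [[i|j]|[b k]]; first by apply: Or31; exists i.
  by apply: Or32; exists j.+1.
apply: Or33; exists (if b then 1 else 2), (3 * k.+1%:Z); split; last by case: b; [left|right].
  rewrite /pI /hP /hP12 (_ : absz (3 * k.+1%:Z) = (3 * k.+1)%N) ?abszM //.
  rewrite dvdn_mulr // mulKn //=.
  by case: b.
by lia.
Qed.

(** Division of the index by 3: the quotient is v and the remainder selects the atom. *)
Lemma e_satom b : exists v x, List.In x basis_satoms /\ e b = aeval e v x.
Proof.
have hdiv (i : int) : exists v, [\/ i = sidx v 1 0, i = sidx v 1 1 | i = sidx v 1 2].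
  exists (i %/ 3)%Z; rewrite /sidx.
  have : [\/ i = 3 * 1 * (i %/ 3)%Z + 0, i = 3 * 1 * (i %/ 3)%Z + 1
           | i = 3 * 1 * (i %/ 3)%Z + 2].
    have := divz_eq i 3; have : [\/ (i %% 3)%Z = 0, (i %% 3)%Z = 1 | (i %% 3)%Z = 2].
      have : (0 <= (i %% 3)%Z < 3) by rewrite modz_ge0 // ltz_pmod.
      by case: (i %% 3)%Z => [[|[|[|]]]|] // _; [apply: Or31|apply: Or32|apply: Or33].
    by case=> -> E; [apply: Or31|apply: Or32|apply: Or33]; rewrite {1}E mulr1 mulrC.
  by [].
case: (e_cases b) => [[i ->]|[j ->]|[r [k [-> hk hr]]]].
- have [v [E|E|E]] := hdiv i; exists v; [exists (SA 1 0)|exists (SA 1 1)|exists (SA 1 2)];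
    rewrite /= -E; split=> //; rewrite /basis_satoms /=; tauto.
- have [v [E|E|E]] := hdiv j; exists v; [exists (SS 1 0)|exists (SS 1 1)|exists (SS 1 2)];
    rewrite /= -E; split=> //; rewrite /basis_satoms /=; tauto.
- have [v E] : exists v, k = sidx v 1 0.
    by exists (k %/ 3)%Z; rewrite /sidx mulr1 mulrC addr0 divzK.
  by exists v; case: hr => ->; [exists (SP 1 1 0)|exists (SP 2 1 0)]; rewrite /= -E;
    split=> //; rewrite /basis_satoms /=; tauto.
Qed.

Definition is_weight (lam : {linear V -> F^o}) : Prop :=
  [/\ forall i, lam (hA e i) = 1, forall j, lam (sI e j) = 0
    & forall r k, lam (pI e r k) = 0].

Definition is_refl (n0 : int) (rho : {linear V -> V}) : Prop :=
  [/\ forall i, rho (hA e i) = hA e (n0 - i), forall j, rho (sI e j) = sI e j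
    & forall r k, rho (pI e r k) = - pI e (zbar n0 - r) k].

End Spanning.

(** * Ideals are stable under suitable reflections *)

Section Invariance.
Variables (F : fieldType) (V : lmodType F) (m : V -> V -> V) (e : hidx -> V).
Hypothesis hF2 : (2%:R : F) != 0.
Hypothesis hr : cover_rels m e.
Variable lam : {linear V -> F^o}.
Hypothesis hlam : is_weight e lam.

Let hm := rels_bil hr.

(** On basis vectors only the coefficients of the a's count: they add up to 1/2 + 1/2 = 1 in (H1),
    to -3/4 + 3/8 + 3/8 = 0 in (H2), and no a occurs in the other products. *)
Lemma weightM x y : lam (m x y) = lam x * lam y.
Proof.
have [hA hS hP] := hlam.
move: x; apply: (span_ind (rels_span hr)) => [|a x x' hx hx'|b].
- by rewrite (bil0l hm) !linear0 mul0r.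
- by rewrite (bilP hm) !linearP hx hx' /= mulrDl -mulrA.
move: y; apply: (span_ind (rels_span hr)) => [|a x x' hx hx'|b'].
- by rewrite (bil0r hm) !linear0 mulr0.
- by rewrite (bilDr hm) (bilZr hm) !linearP hx hx' /= mulrDr mulrCA.
have hZ r k : lam (zI e r k) = 0 by rewrite [zI _ _ _]/(_ - _) linearB /= !hP subr0.
have hZ2 r k r' k' : lam (zI e r k + zI e r' k') = 0 by rewrite linearD /= !hZ addr0.
have nz4 := nz4 hF2; have nz8 := nz8 hF2.
have cAS i j : lam (m (Defs.hA e i) (sI e j)) = 0.
  rewrite (rels_as hr) linearB /= hZ subr0 !(linearD, linearN, linearZ) /= !hA !hS.
  by rewrite /GRing.scale /=; field; rewrite nz4 nz8 hF2.
have cAP i r k : lam (m (Defs.hA e i) (pI e r k)) = 0.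
  by rewrite (rels_ap hr) linearB linearZ /= !hP scaler0 subr0.
have cSP j r k : (3 %| k)%Z -> lam (m (sI e j) (pI e r k)) = 0.
  move=> h; rewrite (rels_sp hr) // !(linearD, linearN, linearZ) /= !hP.
  by rewrite !(oppr0, addr0, scaler0).
have [[i ->]|[j ->]|[r [k [-> hk _]]]] := e_cases e b;
   have [[i' ->]|[j' ->]|[r' [k' [-> hk' _]]]] := e_cases e b'; rewrite ?hA ?hS ?hP ?mulr0 ?mul0r //.
- rewrite (rels_aa hr) linearD /= hZ addr0 !(linearD, linearZ) /= !hA !hS.
  by rewrite /GRing.scale /=; field; rewrite hF2.
- by rewrite (bilC hm).
- by rewrite (rels_ss hr) !(linearD, linearN, linearZ) /= !hS !(oppr0, addr0, scaler0).
- exact: cSP.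
- by rewrite (bilC hm).
- by rewrite (bilC hm) cSP.
- rewrite (rels_pp hr) // linearB !linearZ /=.
  by rewrite !hZ2 !(oppr0, addr0, scaler0).
Qed.

Section Reflection.
Variables (n0 : int) (rho : {linear V -> V}).
Hypothesis hrho : is_refl e n0 rho.

(** No sign appears: the sign of rho on p cancels against the exchange of r + 1 and r - 1. *)
Lemma refl_z r k : rho (zI e r k) = zI e (zbar n0 - r) k.
Proof.
have [_ _ hP] := hrho; rewrite [zI e r k]/(_ - _) linearB /= !hP /zI opprK addrC.
by congr (pI _ _ _ - pI _ _ _); rewrite opprD addrA // opprK.
Qed.

Lemma refl_invol x : rho (rho x) = x.
Proof.
have [hA hS hP] := hrho.
move: x; apply: (span_ind (rels_span hr)) => [|a x x' hx hx'|b].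
- by rewrite !linear0.
- by rewrite !linearP hx hx'.
case: (e_cases e b) => [[i ->]|[j ->]|[r [k [-> hk _]]]].
- by rewrite !hA opprB addrC subrK.
- by rewrite !hS.
- by rewrite hP linearN /= hP opprK opprB addrC subrK.
Qed.

Lemma refl_weight x : lam (rho x) = lam x.
Proof.
have [hA hS hP] := hrho; have [lA lS lP] := hlam.
move: x; apply: (span_ind (rels_span hr)) => [|a x x' hx hx'|b].
- by rewrite !linear0.
- by rewrite !linearP hx hx'.
case: (e_cases e b) => [[i ->]|[j ->]|[r [k [-> hk _]]]].
- by rewrite hA !lA.
- by rewrite !hS.
- by rewrite hP linearN /= !lP oppr0.
Qed.

Lemma reflM x y : rho (m x y) = m (rho x) (rho y).
Proof.
have [hA hS hP] := hrho.
move: x; apply: (span_ind (rels_span hr)) => [|a x x' hx hx'|b].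
- by rewrite (bil0l hm) !linear0 (bil0l hm).
- by rewrite (bilP hm) !linearP hx hx' /= (bilP hm).
move: y; apply: (span_ind (rels_span hr)) => [|a x x' hx hx'|b'].
- by rewrite (bil0r hm) !linear0 (bil0r hm).
- by rewrite (bilDr hm) (bilZr hm) !linearP hx hx' /= (bilDr hm) (bilZr hm).
have zD r k r' k' : rho (zI e r k + zI e r' k') = zI e (zbar n0 - r) k + zI e (zbar n0 - r') k'.
  by rewrite linearD /= !refl_z.
have zB i : zbar (n0 - i) = zbar n0 - zbar i by rewrite zbarD zbarN.
have cAS i j : rho (m (Defs.hA e i) (sI e j)) = m (rho (Defs.hA e i)) (rho (sI e j)).
  rewrite (rels_as hr) hA hS (rels_as hr) linearB /= refl_z !(linearD, linearN, linearZ) /= !hA hS zB.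
  have -> : n0 - (i - j) = n0 - i + j by ring.
  have -> : n0 - (i + j) = n0 - i - j by ring.
  by lmod_coefs F V; ring.
have cAP i r k : rho (m (Defs.hA e i) (pI e r k)) = m (rho (Defs.hA e i)) (rho (pI e r k)).
  rewrite (rels_ap hr) hA !hP (bilNr hm) (rels_ap hr) linearB linearZ /= !hP zB.
  (* Both residues agree because 3 n0 = 0 in Z_3. *)
  have -> : zbar n0 - - (zbar i + r) = - (zbar n0 - zbar i + (zbar n0 - r)).
    by case: (Z3_cases (zbar n0)) (Z3_cases (zbar i)) (Z3_cases r) => -> [] -> [] ->; apply: val_inj.
  by lmod_coefs F V; ring.
have cSP j r k : (3 %| k)%Z -> rho (m (sI e j) (pI e r k)) = m (rho (sI e j)) (rho (pI e r k)).
  move=> h; rewrite (rels_sp hr) // hS hP (bilNr hm) (rels_sp hr) //.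
  rewrite !(linearD, linearN, linearZ) /= !hP.
  by lmod_coefs F V; ring.
have [[i ->]|[j ->]|[r [k [-> hk _]]]] := e_cases e b;
   have [[i' ->]|[j' ->]|[r' [k' [-> hk' _]]]] := e_cases e b'; rewrite //.
- rewrite (rels_aa hr) !hA (rels_aa hr) linearD /= refl_z !(linearD, linearZ) /= !hA hS zB.
  have -> : n0 - i - (n0 - i') = - (i - i') by ring.
  by rewrite sIN zIN; lmod_coefs F V; ring.
- by rewrite (bilC hm) cAS (bilC hm).
- rewrite (rels_ss hr) !hS (rels_ss hr) !(linearD, linearN, linearZ) /= !hS; by lmod_coefs F V; ring.
- exact: cSP.
- by rewrite (bilC hm) cAP (bilC hm).
- by rewrite (bilC hm) cSP // (bilC hm).
- rewrite (rels_pp hr) // !hP (bilNr hm) (bilNl hm) opprK (rels_pp hr) //.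
  rewrite linearB !linearZ /= !zD.
  suff -> : zbar n0 - - (zbar r + zbar r') = - (zbar n0 - zbar r + (zbar n0 - zbar r')).
    by lmod_coefs F V; ring.
  by case: (Z3_cases (zbar n0)) (Z3_cases (zbar r)) (Z3_cases (zbar r')) => -> [] -> [] ->; apply: val_inj.
Qed.

Lemma vactP W (a : F) x y : vact m e W (a *: x + y) = a *: vact m e W x + vact m e W y.
Proof.
rewrite /vact scaler_sumr -big_split; apply: eq_bigr => w _ /=.
rewrite scalerA [a * _]mulrC -scalerA -scalerDr; congr (_ *: _).
elim: w.2 => //= g s ->; rewrite /sop (bilDr hm) (bilZr hm) scalerDr.
by rewrite !scalerA mulrC.
Qed.

Lemma vact0 W : vact m e W 0 = 0.
Proof. by have := vactP W (-1) 0 0; rewrite scaler0 addr0 scaleN1r addNr. Qed.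

Lemma leval_refl v l : leval e v (srefl n0 l) = rho (leval e v l).
Proof.
have [hA hS hP] := hrho; rewrite /leval big_map linear_sum; apply: eq_bigr => t _.
rewrite linearZ /=; case: t => z [n c|n c|r n c] /=.
- by rewrite hA; congr (_ *: Defs.hA e _); rewrite /sidx; ring.
- by rewrite hS.
- by rewrite hP zFN scaleNr scalerN zbarD zbarN.
Qed.

Variables (W : seq sword) (N : Z).
Hypothesis hW : all (srefl_check W N n0) basis_satoms.

Let defect x := vact m e W x - zF F (N * 8 ^+ 3) *: rho x.

(** Both sides are linear in [x], and every basis vector is a checked atom for a suitable v. *)
Lemma vact_refl x :
  vact m e W x = zF F (N * 8 ^+ 3) *: rho x + lam x *: defect (hA e 0).
Proof.
have [lA lS lP] := hlam.
move: x; apply: (span_ind (rels_span hr)) => [|a x x' hx hx'|b].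
- by rewrite vact0 !linear0 scale0r addr0.
- rewrite vactP hx hx' !linearP /=; lmod_coefs F V; try ring.
  by rewrite /GRing.scale /=; ring.
have [v [x [hx ->]]] := e_satom e b.
have hd l : leval e v (srefl_defect W N n0 l) = defect (leval e v l).
  by rewrite leval_cat (sactP hF2 hr) leval_scale leval_refl zFN scaleNr.
have : srefl_check W N n0 x.
  by elim: basis_satoms hx hW => //= y s IH [->|h] /andP[] // _; apply: IH.
move/leval_null => /(_ _ _ e hF2 v); rewrite leval_cat leval_scale !hd.
rewrite !leval_cons !leval_nil /= !scale1r !addr0 zFN sidx0.
have -> : zF F (sweight x) = lam (aeval e v x).
  by case: x {hx} => [n c|n c|r n c] /=; rewrite ?lA ?lS ?lP.
move=> h; apply/eqP; rewrite -subr_eq0 opprD addrA; apply/eqP.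
by rewrite -[RHS]h scaleNr.
Qed.

Hypothesis hN : zF F (N * 8 ^+ 3) != 0.

(** In weight 0 the word preserves I and is an invertible multiple of rho; weight 1 reduces to
    weight 0 through the product with the reflected element; any other weight is rescaled to 1. *)
Lemma ideal_refl (I : V -> Prop) : is_ideal m I -> forall x, I x -> I (rho x).
Proof.
move=> [I0 [IL IM]].
have IZ a x : I x -> I (a *: x) by move=> h; rewrite -[a *: x]addr0; apply: IL.
have ID x y : I x -> I y -> I (x + y).
  by move=> h h'; rewrite -[x]scale1r; apply: IL.
have Iact x : I x -> I (vact m e W x).
  move=> hx; rewrite /vact; elim: W => [|w s IH]; first by rewrite big_nil.
  rewrite big_cons; apply: (ID) => //; apply: (IZ).
  by elim: w.2 => //= g t ht; apply: (IZ); have [] := IM _ (sgen_val e g) ht.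
have I_null x : lam x = 0 -> I x -> I (rho x).
  move=> lx /Iact; rewrite vact_refl lx scale0r addr0 => /(IZ (zF F (N * 8 ^+ 3))^-1).
  by rewrite scalerA mulVf // scale1r.
(* [y = rho x * x - x] is a weight zero element of [I], and
   [rho y = x * rho x - rho x]. *)
have I_one x : lam x = 1 -> I x -> I (rho x).
  move=> lx hx; have [h1 h2] := IM _ (rho x) hx.
  have ly : lam (m (rho x) x + (-1) *: x) = 0.
    by rewrite linearD weightM refl_weight linearZ /= lx mulr1 /GRing.scale /= mulr1 subrr.
  have := I_null _ ly (ID _ _ h2 (IZ _ _ hx)).
  rewrite linearD linearZ /= reflM refl_invol => /(IZ (-1)) /(ID _ _)/(_ h1).
  by rewrite scalerDr scalerA mulN1r opprK scale1r scaleN1r addrAC addNr add0r.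
move=> x hx; have [lx|lx] := eqVneq (lam x) 0; first exact: I_null.
have /I_one/(_ (IZ _ _ hx)) : lam ((lam x)^-1 *: x) = 1 by rewrite linearZ; apply: mulVf.
by rewrite linearZ => /(IZ (lam x)); rewrite scalerA mulfV // scale1r.
Qed.

End Reflection.
End Invariance.

(** * Existence of the weight and of the reflections *)

Section Extensions.
Variables (F : fieldType) (V W : lmodType F).

(** Values on the basis determine those on the integer-indexed families once the targets obey the
    same conventions: evenness, vanishing, and p_0 = - p_1 - p_2. *)
Lemma hidx_ext (e : hidx -> V) (f : {linear V -> W}) (gA gS : int -> W) (gP : 'Z_3 -> int -> W) :
  gS 0 = 0 -> (forall j, gS (- j) = gS j) ->
  (forall r k, ~~ (3 %| k)%Z || (k == 0) -> gP r k = 0) ->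
  (forall r k, gP r (- k) = gP r k) ->
  (forall k, gP 0 k = - (gP 1 k + gP 2 k)) ->
  (forall i, f (e (inl (inl i))) = gA i) ->
  (forall j : nat, f (e (inl (inr j))) = gS j.+1) ->
  (forall b (k : nat), f (e (inr (b, k))) = gP (if b then 1 else 2) (3 * k.+1%:Z)) ->
  [/\ forall i, f (hA e i) = gA i, forall j, f (sI e j) = gS j
    & forall r k, f (pI e r k) = gP r k].
Proof.
move=> gS0 gSN gP0 gPN gPr hA hS hP; split=> //.
  by elim/int_sym1 => [[|j]|j IH]; rewrite ?sIN ?gSN // ?sI0 ?linear0 ?gS0 //; exact: hS.
have hP12 b (k : nat) : f (hP12 e b k) = gP (if b then 1 else 2) k.
  rewrite /hP12; case: ifP => [/andP[k0 /dvdnP[q E]]|h].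
    have q0 : (0 < q)%N by move: k0; rewrite E muln_gt0 => /andP[].
    by rewrite hP E mulnK // prednK // mulnC PoszM.
  rewrite linear0 gP0 //; apply/orP; move: h; rewrite dvdzE /=.
  case: k => [|k] /= h; first by right.
  by left; rewrite h.
move=> r k; elim/int_sym1: k => [k|k IH]; last by rewrite pIN gPN.
by rewrite /pI /hP /=; case: (Z3_cases r) => -> /=; rewrite ?gPr ?linearN ?linearD /= !hP12.
Qed.
End Extensions.

Section Existence.
Variables (F : fieldType) (V : lmodType F).

Definition weight_val (b : hidx) : F^o := if b is inl (inl _) then 1 else 0.

Definition refl_val (e : hidx -> V) (n0 : int) (b : hidx) : V :=
  match b with
  | inl (inl i) => hA e (n0 - i)
  | inl (inr j) => sI e j.+1
  | inr (b, k) => - pI e (zbar n0 - if b then 1 else 2) (3 * k.+1%:Z)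
  end.

Lemma weightP (e : hidx -> V) (lam : {linear V -> F^o}) :
  (forall b, lam (e b) = weight_val b) -> is_weight e lam.
Proof.
move=> h; apply: (@hidx_ext _ _ _ _ _ (fun=> 1) (fun=> 0) (fun _ _ => 0)) => //.
by move=> _; rewrite addr0 oppr0.
Qed.

Lemma reflP (e : hidx -> V) (n0 : int) (rho : {linear V -> V}) :
  (forall b, rho (e b) = refl_val e n0 b) -> is_refl e n0 rho.
Proof.
move=> h; apply: (@hidx_ext _ _ _ _ _ (fun i => hA e (n0 - i)) (sI e)
                   (fun r k => - pI e (zbar n0 - r) k)).
- by [].
- exact: sIN.
- by move=> r k hk; rewrite pI_eq0 ?oppr0.
- by move=> r k; rewrite pIN.
(* The convention for p_0 is used for all residues at once: the three p_r with the same k add up to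
   0. *)
- move=> k; have hs r : pI e r k = - (pI e (r - 1) k + pI e (r - 2) k).
    by case: (Z3_cases r) => ->; rewrite /pI /hP /=; lmod_coefs F V; ring.
  by rewrite subr0 (hs (zbar n0)) -opprD.
- by move=> i; rewrite h.
- by move=> j; rewrite h.
- by move=> b k; rewrite h.
Qed.

Lemma Hhat_weight_refl (m : V -> V -> V) (e : hidx -> V) : is_Hhat m e ->
  (exists lam, is_weight e lam) /\ forall n0, exists rho, is_refl e n0 rho.
Proof.
case=> _ he _; split=> [|n0].
  by have [lam h] := basis_linear_ext weight_val he; exists lam; apply: weightP.
by have [rho h] := basis_linear_ext (refl_val e n0) he; exists rho; apply: reflP.
Qed.

Lemma Highwater_weight_refl (m : V -> V -> V) (e : widx -> V) : is_Highwater m e ->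
  (exists lam, is_weight (widx_ext e) lam) /\
  forall n0, exists rho, is_refl (widx_ext e) n0 rho.
Proof.
case=> _ he _ _ _; split=> [|n0].
  have [lam h] := basis_linear_ext (fun w => weight_val (inl w)) he; exists lam; apply: weightP.
  by case=> [w|b] /=; rewrite ?h ?linear0.
have [rho h] := basis_linear_ext (fun w => refl_val (widx_ext e) n0 (inl w)) he.
exists rho; apply: reflP => -[w|[b k]] /=; first by rewrite h.
by rewrite linear0 pI_widx oppr0.
Qed.
End Existence.

(** * Generation by a_0 and a_1 *)

Section Generation.
Variables (F : fieldType) (V : lmodType F) (m : V -> V -> V) (e : hidx -> V).
Hypothesis hF2 : (2%:R : F) != 0.
Hypothesis hF3 : (3%:R : F) != 0.
Hypothesis hr : cover_rels m e.

Let nz4 := nz4 hF2.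
Let nz8 := nz8 hF2.
Let a := hA e.
Let s := sI e.

Lemma zI_unit r (d : int) : `|d|%N = 1%N -> zI e r d = 0.
Proof. by move=> hd; rewrite zI_eq0 // dvdzE hd. Qed.

Lemma sI_unit (d : int) : `|d|%N = 1%N -> s d = s 1.
Proof. by rewrite /s /sI => ->. Qed.

(** This is (H2) for s_1 solved for a_{i+d}; taking d = 1 or d = -1 gives a recursion in both
    directions. *)
Lemma a_next i (d : int) : `|d|%N = 1%N ->
  a (i + d) = (8 / 3 : F) *: m (a i) (s 1) + (2 : F) *: a i - a (i - d) - (4 : F) *: s 1.
Proof.
move=> hd; have -> : m (a i) (s 1) = m (a i) (s d) by rewrite (sI_unit hd).
rewrite (rels_as hr) -/a -/s (zI_unit _ hd) (sI_unit hd).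
by lmod_coefs F V; field; rewrite ?nz4 ?nz8 ?hF2 ?hF3.
Qed.

Lemma s1E : s 1 = m (a 0) (a 1) - (2^-1 : F) *: (a 0 + a 1).
Proof.
rewrite (rels_aa hr) -/a -/s zI_unit //.
by lmod_coefs F V; field.
Qed.

(** The product a_0 a_1 yields s_1, the recursion yields all a_i, the products a_i a_{i+j} yield s_j
    + z_{i,j}, and averaging over the residue of i separates s_j from z. *)
Lemma cover_generated : generated_by2 m (hA e 0) (hA e 1).
Proof.
move=> S [S0 [SL SM]] Sa0 Sa1.
have SZ c x : S x -> S (c *: x) by move=> h; rewrite -[c *: x]addr0; apply: (SL).
have SD x y : S x -> S y -> S (x + y).
  by move=> h h'; rewrite -[x]scale1r; apply: (SL).
have SB x y : S x -> S y -> S (x - y).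
  by move=> h h'; rewrite -scaleN1r; apply: (SD) => //; apply: (SZ).
have Ss1 : S (s 1) by rewrite s1E; apply: (SB); [apply: (SM)|apply/SZ/SD].
have Snext i d : `|d|%N = 1%N -> S (a i) -> S (a (i - d)) -> S (a (i + d)).
  move=> hd h h'; rewrite a_next //.
  by apply: (SB); [apply: (SB) => //; apply: (SD); apply: (SZ) => //; apply: (SM)|apply: (SZ)].
have Sa i : S (a i).
  (* The recursion has order two, so the induction runs over consecutive pairs. *)
  suff : S (a i) /\ S (a (i + 1)) by case.
  elim: i => [|n [IH1 IH2]|n [IH1 IH2]]; first by rewrite add0r.
    rewrite intS addrC; split=> //; apply: Snext => //.
    by rewrite addrK.
  have E : - n.+1%:Z = - n%:Z - 1 by rewrite intS opprD addrC.
  by rewrite E subrK; split=> //; apply: Snext.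
have Ssz i j : S (s j + zI e (zbar i) j).
  have -> : s j + zI e (zbar i) j = m (a i) (a (i + j)) - (2^-1 : F) *: (a i + a (i + j)).
    rewrite (rels_aa hr) -/a (_ : i - (i + j) = - j); last by ring.
    rewrite sIN zIN.
    by lmod_coefs F V; ring.
  by apply: (SB); [apply: (SM)|apply/SZ/SD].
have Ss j : S (s j).
  (* The three z_{r,j} add up to 0. *)
  have -> : s j = (3^-1 : F) *: ((s j + zI e (zbar 0) j) + (s j + zI e (zbar 1) j)
                              + (s j + zI e (zbar 2) j)).
    rewrite zbar0 zbar1 zbar2 /zI /pI /hP /=.
    by lmod_coefs F V; field; rewrite ?hF3.
  by apply/SZ/SD => //; apply: (SD).
have Sz i j : S (zI e (zbar i) j).
  by rewrite -[zI _ _ _](addKr (s j)) addrC; apply: (SB).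
have Sp r j : S (pI e r j).
  (* Since p_{r+1} + p_{r-1} = - p_r, the difference z_{r-1} - z_{r+1} is 3 p_r. *)
  have -> : pI e r j = (3^-1 : F) *: (zI e (r - 1) j - zI e (r + 1) j).
    by case: (Z3_cases r) => ->; rewrite /zI /pI /hP /=; lmod_coefs F V; field; rewrite ?hF3.
  have zB : exists i i', r - 1 = zbar i /\ r + 1 = zbar i'.
    exists (r%:Z - 1), (r%:Z + 1); rewrite zbarB1 zbarD1.
    by have -> : zbar r%:Z = r by case: (Z3_cases r) => ->; apply: val_inj.
  by have [i [i' [-> ->]]] := zB; apply/SZ/SB.
apply: (span_ind (rels_span hr)) => // b.
by case: (e_cases e b) => [[i ->]|[j ->]|[r [k [-> _ _]]]].
Qed.

End Generation.

(** * Symmetry of the quotients *)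

Section Quotients.
Variables (F : fieldType) (V : lmodType F) (m : V -> V -> V) (e : hidx -> V).
Hypothesis hF2 : (2%:R : F) != 0.
Hypothesis hF3 : (3%:R : F) != 0.
Hypothesis hr : cover_rels m e.
Variable lam : {linear V -> F^o}.
Hypothesis hlam : is_weight e lam.
Variable I : V -> Prop.
Hypothesis hI : is_ideal m I.

Lemma ideal_refl0 (rho : {linear V -> V}) : is_refl e 0 rho -> forall x, I x -> I (rho x).
Proof.
move=> hrho; apply: (ideal_refl hF2 hr hlam hrho refl0_check) => //.
by rewrite zFM zFX !zFn mulf_neq0 // expf_neq0 // (nz8 hF2).
Qed.

Lemma ideal_refl1 (rho : {linear V -> V}) : is_refl e 1 rho -> forall x, I x -> I (rho x).
Proof.
move=> hrho; apply: (ideal_refl hF2 hr hlam hrho refl1_check) => //.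
rewrite zFM zFX !zFn mulf_neq0 // ?expf_neq0 // ?(nz8 hF2) //.
(* Only the primes 2 and 3 divide 36 and 8. *)
by rewrite (natrM F 4 9) (natrM F 3 3) !mulf_neq0 // (nz4 hF2).
Qed.

(** The reflection rho_1 exchanges a_0 and a_1 and preserves I, so it descends to the quotient;
    generation passes to the images. *)
Lemma quotient_symmetric (rho : {linear V -> V}) (Q : lmodType F) (mQ : Q -> Q -> Q)
    (phi : V -> Q) :
  is_refl e 1 rho -> quotient_by m mQ I phi -> symmetric_alg mQ (phi (hA e 0)) (phi (hA e 1)).
Proof.
move=> hrho [[phiL phiM] phi_surj phi_ker].
have rhoI := ideal_refl1 hrho.
have phi0 : phi 0 = 0 by apply/phi_ker; case: hI.
have phiB x y : phi (x - y) = phi x - phi y.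
  by rewrite -scaleN1r addrC phiL scaleN1r addrC.
split.
  move=> S [S0 [SL SM]] h0 h1 y; have [x <-] := phi_surj y.
  apply: (cover_generated hF2 hF3 hr (S := fun x => S (phi x))) => //; split; first by rewrite phi0.
  by split=> [a u w|u w]; [rewrite phiL; apply: SL|rewrite phiM; apply: SM].
pose lift y := proj1_sig (constructive_indefinite_description _ (phi_surj y)).
have liftK y : phi (lift y) = y by rewrite /lift; case: constructive_indefinite_description.
pose f y := phi (rho (lift y)).
(* Independence of the lift: two lifts differ by an element of I, which rho keeps in I. *)
have fE x : f (phi x) = phi (rho x).
  apply/eqP; rewrite -subr_eq0 -phiB -linearB; apply/eqP/phi_ker/rhoI/phi_ker.
  by rewrite phiB liftK subrr.
have fK y : f (f y) = y.
  by rewrite -{1}[y]liftK !fE (refl_invol hr hrho) liftK.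
have [hA _ _] := hrho.
exists f; split=> //; try by rewrite fE hA.
split; last by exists f.
split=> [a x y|x y]; rewrite -[x]liftK -[y]liftK.
  by rewrite -phiL !fE linearP phiL.
by rewrite -phiM !fE (reflM hr hrho) phiM.
Qed.

End Quotients.

(** * Idempotents *)

Section LinearCombination.
Variables (F : fieldType) (V : lmodType F).
Implicit Types (P Q : {poly F}).

(** The linear map with X^i sent to [w i]. Coefficient vectors are stored as polynomials to make
    degree and divisibility arguments available. *)
Definition lc (w : nat -> V) (P : {poly F}) : V := \sum_(i < size P) P`_i *: w i.

Lemma lcE n w P : (size P <= n)%N -> lc w P = \sum_(i < n) P`_i *: w i.
Proof.
move=> h; rewrite /lc (big_ord_widen n (fun i => P`_i *: w i)) // big_mkcond /=.
apply: eq_bigr => i _; case: ltnP => // hi.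
by rewrite nth_default // scale0r.
Qed.

Lemma lc0 w : lc w 0 = 0.
Proof. by rewrite /lc size_poly0 big_ord0. Qed.

Lemma lc_linear w (a : F) P Q : lc w (a *: P + Q) = a *: lc w P + lc w Q.
Proof.
pose n := maxn (size P) (maxn (size Q) (size (a *: P + Q))).
rewrite !(@lcE n) ?leq_max ?leqnn ?orbT // scaler_sumr -big_split /=.
by apply: eq_bigr => i _; rewrite coefD coefZ scalerDl scalerA.
Qed.

Lemma lcXn w n : lc w 'X^n = w n.
Proof.
rewrite /lc size_polyXn big_ord_recr /= coefXn eqxx scale1r big1 ?add0r // => i _.
by rewrite coefXn ltn_eqF // scale0r.
Qed.

Lemma lc_shift w k P : lc w ('X^k * P) = lc (fun i => w (k + i)%N) P.
Proof.
rewrite (@lcE (k + size P)); last first.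
  have [->|P0] := eqVneq P 0; first by rewrite mulr0 size_poly0.
  by rewrite size_monicM ?monicXn // size_polyXn addSn.
rewrite big_split_ord /= big1 ?add0r => [|i _].
  by apply: eq_bigr => i _; rewrite coefXnM ltnNge leq_addr addKn.
by rewrite coefXnM ltn_ord scale0r.
Qed.

Lemma eq_lc w w' P : w =1 w' -> lc w P = lc w' P.
Proof. by move=> h; apply: eq_bigr => i _; rewrite h. Qed.
End LinearCombination.

Lemma linear_lc (F : fieldType) (V W : lmodType F) (f : {linear V -> W}) w P :
  f (lc w P) = lc (fun i => f (w i)) P.
Proof. by rewrite linear_sum; apply: eq_bigr => i _; rewrite linearZ. Qed.

Lemma lc_poly (F : fieldType) (P : {poly F}) : lc (fun i => 'X^i : {poly F}) P = P.
Proof. by rewrite /lc -poly_def coefK. Qed.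

(* K with the F-module structure given by iota. *)
Definition scalar_ext (F K : fieldType) (iota : {rmorphism F -> K}) : Type := K.
HB.instance Definition _ (F K : fieldType) (iota : {rmorphism F -> K}) :=
  GRing.Field.copy (scalar_ext iota) K.

(** * Laurent polynomials in a transcendental element *)

Section RatFun.
Variables (F K0 : fieldType) (ratc : {rmorphism F -> K0}) (rat_t : K0).
Local Notation K := (scalar_ext ratc).

Definition rat_scale (c : F) (x : K) : K := ratc c * x.
Lemma rat_scaleA a b x : rat_scale a (rat_scale b x) = rat_scale (a * b) x.
Proof. by rewrite /rat_scale rmorphM mulrA. Qed.
Lemma rat_scale1 : left_id 1 rat_scale.
Proof. by move=> x; rewrite /rat_scale rmorph1 mul1r. Qed.
Lemma rat_scaleDr : right_distributive rat_scale +%R.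
Proof. by move=> a x y; rewrite /rat_scale mulrDr. Qed.
Lemma rat_scaleDl x : {morph rat_scale^~ x : a b / a + b}.
Proof. by move=> a b; rewrite /rat_scale rmorphD mulrDl. Qed.
HB.instance Definition _ :=
  GRing.Zmodule_isLmodule.Build F K rat_scaleA rat_scale1 rat_scaleDr rat_scaleDl.

Lemma rat_scaleE (c : F) (x : K) : c *: x = ratc c * x. Proof. by []. Qed.

(** Evaluation at t; the hypothesis [ratp_inj] below says that t is transcendental over F. *)
Definition ratp : {poly F} -> K0 := horner_eval rat_t \o map_poly ratc.
HB.instance Definition _ := GRing.RMorphism.on ratp.

Hypothesis ratp_inj : injective ratp.

Lemma ratpZ (a : F) P : ratp (a *: P) = ratc a * ratp P.
Proof. by rewrite -mul_polyC rmorphM /= /ratp /= map_polyC /horner_eval hornerC. Qed.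

Lemma ratp_lc (w : nat -> {poly F}) P : ratp (lc w P) = lc (fun i => ratp (w i) : K) P.
Proof. by rewrite rmorph_sum; apply: eq_bigr => i _; rewrite /= ratpZ. Qed.

Lemma ratpX : ratp 'X = rat_t.
Proof. by rewrite /ratp /= map_polyX /horner_eval hornerX. Qed.

Lemma rat_t_neq0 : rat_t != 0.
Proof.
apply/eqP => h; have /eqP[] := negbT (polyX_eq0 F); apply: ratp_inj.
by rewrite ratpX rmorph0.
Qed.

Lemma rat_tXn n : rat_t ^ n%:Z = ratp 'X^n.
Proof. by rewrite -exprnP rmorphXn /= ratpX. Qed.

Lemma ratp_lcX P : ratp P = lc (fun i => rat_t ^ i%:Z : K) P :> K.
Proof.
rewrite -[in LHS](lc_poly P) (ratp_lc _ P : _ = _ :> K).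
by apply: eq_lc => i; rewrite rat_tXn.
Qed.

Lemma rat_tD i j : rat_t ^ (i + j) = rat_t ^ i * rat_t ^ j.
Proof. exact: expfzDr rat_t_neq0. Qed.

(* The image of s_j. *)
Definition rat_sym (j : int) : K0 := rat_t ^ j + rat_t ^ (- j) - 2.

Lemma rat_symN j : rat_sym (- j) = rat_sym j.
Proof. by rewrite /rat_sym opprK [_ ^ (- j) + _]addrC. Qed.
Lemma rat_sym0 : rat_sym 0 = 0.
Proof. by rewrite /rat_sym oppr0 expr0z subrr. Qed.

(** Multiplied by -3/8, the right-hand side is that of (H4), so s_j s_l corresponds to -3/8 times
    the product of the images. *)
Lemma rat_symM j l : rat_sym j * rat_sym l =
  rat_sym (j + l) + rat_sym (j - l) - 2 * rat_sym j - 2 * rat_sym l.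
Proof.
rewrite /rat_sym !opprD !opprK !rat_tD.
by ring.
Qed.

(** A nonzero combination has a top positive power of t, which no constant can match. *)
Lemma lc_sym_const (d : nat) (Q : {poly F}) (c : F) : (0 < d)%N ->
  lc (fun j => rat_sym (d * j.+1)%N : K) Q = ratc c -> Q = 0.
Proof.
move=> d0 h; apply/eqP/negPn/negP => Q0.
(* Multiplication by t^n clears the negative powers; the coefficient of X^(2n) then sees only the
   leading coefficient of Q. *)
pose n := (d * size Q)%N.
have sQ : (0 < size Q)%N by rewrite size_poly_gt0.
have n0 : (0 < n)%N by rewrite muln_gt0 d0.
pose w j : {poly F} := 'X^(n + d * j.+1) + 'X^(n - d * j.+1) - 'X^n *+ 2.
have : lc w Q = c *: 'X^n.
  apply: ratp_inj; rewrite ratp_lc ratpZ -h.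
  rewrite /lc mulr_suml; apply: eq_bigr => j _; rewrite /w.
  rewrite rmorphB rmorphD rmorphMn /= -!rat_tXn -mulrA; congr (_ * _).
  have hj : (d * j.+1 <= n)%N by rewrite leq_mul2l ltn_ord orbT.
  rewrite PoszD -(subzn hj) !rat_tD /rat_sym.
  by ring.
have aux1 (a b : nat) : (0 < a)%N -> (a + a == a - b)%N = false by lia.
have aux2 (a : nat) : (0 < a)%N -> (a + a == a)%N = false by lia.
have wE j : (w j)`_(n + n) = (j.+1 == size Q)%:R.
  have j0 : (0 < d * j.+1)%N by rewrite muln_gt0 d0.
  rewrite /w !(coefD, coefN, coefMn) !coefXn eqn_add2l eq_sym /n eqn_pmul2l // -/n.
  by rewrite (aux1 _ _ n0) (aux2 _ n0) /= !addr0 subr0.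
move/(congr1 (fun P : {poly F} => P`_(n + n))); rewrite {1}/lc coef_sum coefZ coefXn.
rewrite (aux2 _ n0) mulr0.
rewrite (eq_bigr (fun j : 'I__ => Q`_j * (j.+1 == size Q)%:R)) => [|j _]; last first.
  by rewrite coefZ wE.
have hk : ((size Q).-1 < size Q)%N by rewrite prednK.
rewrite (bigD1 (Ordinal hk)) //= prednK // eqxx mulr1 big1 => [|j /eqP hj].
  by move/eqP; rewrite addr0 lead_coef_eq0 (negPf Q0).
case: eqP => [E|_]; last by rewrite mulr0.
by case: hj; apply: val_inj; exact: (congr1 predn E).
Qed.

(** The second factor is the first with t replaced by 1/t. Multiplied by a power of t, the equation
    says that P divides X^n. *)
Lemma lc_unit (N : int) (P : {poly F}) :
  lc (fun i => rat_t ^ (i%:Z - N) : K) P * lc (fun i => rat_t ^ (N - i%:Z) : K) P = 1 ->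
  exists (c : F) k, P = c *: 'X^k.
Proof.
move=> h; pose n := size P.
(* The shifts by N and -N cancel, and the remaining factor t^n makes all exponents nonnegative. *)
have : P * lc (fun i => 'X^(n - i)) P = 'X^n.
  apply: ratp_inj; rewrite rmorphM /= ratp_lcX ratp_lc -rat_tXn -[RHS]mulr1 -h /=.
  rewrite /lc !mulr_suml mulr_sumr; apply: eq_bigr => i _.
  rewrite mulr_sumr !mulr_sumr; apply: eq_bigr => j _.
  have hj : (j <= n)%N by rewrite ltnW.
  rewrite -!rat_tXn -(subzn hj) !rat_tD !rat_scaleE.
  have hN : rat_t ^ N * rat_t ^ (- N) = 1 by rewrite -rat_tD subrr.
  transitivity (ratc P`_i * rat_t ^ i%:Z * (ratc P`_j * (rat_t ^ n%:Z * rat_t ^ (- j%:Z)))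
     * (rat_t ^ N * rat_t ^ (- N))); first by rewrite hN mulr1.
  by ring.
move=> E; have : P %| ('X - 0%:P) ^+ n by rewrite subr0 -E dvdp_mulr.
case/dvdp_exp_XsubCP => k _; rewrite subr0 => /eqpf_eq[c _ ->].
by exists c, k.
Qed.
End RatFun.

(** * Normal form of an element *)

Section NormalForm.
Variables (F : fieldType) (V : lmodType F) (e : hidx -> V).

(** The shift by N accommodates negative indices. The factors 1 and 3 in [lcS] and [lcP] play the
    role of d in [lc_sym_const], and j.+1 skips the zero vectors s_0 and p_{r,0}. *)
Definition lcA (N : nat) (P : {poly F}) := lc (fun i => hA e (i%:Z - N%:Z)) P.
Definition lcS (Q : {poly F}) := lc (fun j => sI e (1 * j.+1)%N) Q.
Definition lcP (r : 'Z_3) (R : {poly F}) := lc (fun k => pI e r (3 * k.+1)%N) R.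

Lemma lcA_shift N M P : lcA N P = lcA (N + M) ('X^M * P).
Proof.
by rewrite /lcA lc_shift; apply: eq_lc => i; rewrite !PoszD; congr hA; ring.
Qed.

Lemma normal_form : spanning e -> forall v, exists N P Q R1 R2,
  v = lcA N P + lcS Q + (lcP 1 R1 + lcP 2 R2).
Proof.
move=> hs; apply: (span_ind hs) => [|a x y|b].
- by exists 0%N, 0, 0, 0, 0; rewrite /lcA /lcS /lcP !lc0 !addr0.
- move=> [N [P [Q [R1 [R2 ->]]]]] [N' [P' [Q' [R1' [R2' ->]]]]].
  (* Both A-parts are brought to the common shift N + N'. *)
  exists (N + N')%N, (a *: ('X^N' * P) + 'X^N * P'), (a *: Q + Q'), (a *: R1 + R1'), (a *: R2 + R2').
  rewrite (lcA_shift N N') (lcA_shift N' N) [(N' + N)%N]addnC /lcA /lcS /lcP !lc_linear.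
  by lmod_coefs F V; ring.
case: (e_cases e b) => [[i ->]|[j ->]|[r [k [-> hk hr]]]].
- exists `|i|%N, 'X^(`|i + `|i|%N%:Z|), 0, 0, 0.
  rewrite /lcA /lcS /lcP !lc0 !addr0 lcXn gez0_abs ?addrK //.
  by rewrite -(opprK i) addrC subr_ge0 abszN abszE ler_norm.
- have -> : sI e j = sI e `|j|%N by rewrite /sI absz_nat.
  case: `|j|%N => [|n].
    by exists 0%N, 0, 0, 0, 0; rewrite /lcA /lcS /lcP !lc0 !addr0.
  exists 0%N, 0, 'X^n, 0, 0.
  by rewrite /lcA /lcS /lcP !lc0 !addr0 add0r lcXn mul1n.
- have -> : pI e (zbar r) k = pI e (zbar r) `|k|%N by rewrite /pI absz_nat.
  have /dvdnP[q ->] : (3 %| `|k|)%N by [].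
  case: q => [|n].
    by exists 0%N, 0, 0, 0, 0; rewrite pI0 /lcA /lcS /lcP !lc0 !addr0.
  case: hr => ->; [exists 0%N, 0, 0, 'X^n, 0|exists 0%N, 0, 0, 0, 'X^n];
    by rewrite /lcA /lcS /lcP !lc0 ?addr0 !add0r lcXn mulnC ?zbar2.
Qed.
End NormalForm.

Section LinearMaps.
Variables (F : fieldType) (V W : lmodType F) (m : V -> V -> V) (e : hidx -> V).

Lemma Hhat_linear_ext (gA gS : int -> W) (gP : 'Z_3 -> int -> W) : is_Hhat m e ->
  gS 0 = 0 -> (forall j, gS (- j) = gS j) ->
  (forall r k, ~~ (3 %| k)%Z || (k == 0) -> gP r k = 0) ->
  (forall r k, gP r (- k) = gP r k) ->
  (forall k, gP 0 k = - (gP 1 k + gP 2 k)) ->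
  exists f : {linear V -> W}, [/\ forall i, f (hA e i) = gA i,
    forall j, f (sI e j) = gS j & forall r k, f (pI e r k) = gP r k].
Proof.
move=> [_ he _] gS0 gSN gP0 gPN gPr.
pose g (b : hidx) : W := match b with
  | inl (inl i) => gA i
  | inl (inr j) => gS j.+1
  | inr (b, k) => gP (if b then 1 else 2) (3 * k.+1%:Z)
  end.
have [f hf] := basis_linear_ext g he; exists f.
by apply: hidx_ext => // *; rewrite hf.
Qed.
End LinearMaps.

(** Proves an equation from a certificate [a], [b], leaving a polynomial identity to [field]; a
    single hypothesis is passed twice with [b] = 0. *)
Lemma comb_eq0 (R : pzRingType) (a b x y z : R) :
  x = 0 -> y = 0 -> z = a * x + b * y -> z = 0.
Proof. by move=> -> -> ->; rewrite !mulr0 addr0. Qed.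

Lemma eq_subr0 (R : pzRingType) (x y : R) : x = y -> x - y = 0.
Proof. by move=> ->; rewrite subrr. Qed.

(** * Classification of the idempotents *)

Section Idempotents.
Variables (F : fieldType) (V : lmodType F) (m : V -> V -> V) (e : hidx -> V).
Hypothesis hF2 : (2%:R : F) != 0.
Hypothesis hF3 : (3%:R : F) != 0.
Hypothesis hH : is_Hhat m e.

Variables (K0 : fieldType) (ratc : {rmorphism F -> K0}) (t : K0).
Hypothesis ratp_inj : injective (ratp ratc t).

Local Notation K := (scalar_ext ratc).
Local Notation rat_sym := (rat_sym t).
Let hr := Hhat_rels hF2 hH.
Let hm := rels_bil hr.

Lemma ratc_nat n : ratc n%:R = n%:R :> K. Proof. exact: rmorph_nat. Qed.
Lemma ratc_neq0 n : (n%:R : F) != 0 -> (n%:R : K) != 0.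
Proof. by rewrite -ratc_nat fmorph_eq0. Qed.

Let k2 := ratc_neq0 hF2.
Let k3 := ratc_neq0 hF3.
Let k4 := ratc_neq0 (nz4 hF2).
Let k8 := ratc_neq0 (nz8 hF2).

(* Coordinates of p_r with respect to p_1, p_2. *)
Definition p_coord (b : bool) (r : 'Z_3) : K :=
  if r == 0 then -1 else if r == (if b then 1 else 2) then 1 else 0.

Definition p_val (b : bool) (r : 'Z_3) (k : int) : K :=
  if (3 %| k)%Z then p_coord b r * rat_sym k else 0.

(** Coordinates with values in K: [c] is the weight, [al] and [be] read the A-part in t and in 1/t,
    [ga] reads the S-part, [et1] and [et2] the components along p_1 and p_2. *)
Definition laurent_maps (c al be ga et1 et2 : {linear V -> K}) : Prop :=
  [/\ [/\ forall i, c (hA e i) = 1, forall j, c (sI e j) = 0 & forall r k, c (pI e r k) = 0],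
      [/\ forall i, al (hA e i) = t ^ i, forall j, al (sI e j) = 0 & forall r k, al (pI e r k) = 0],
      [/\ forall i, be (hA e i) = t ^ (- i), forall j, be (sI e j) = 0 & forall r k, be (pI e r k) = 0],
      [/\ forall i, ga (hA e i) = 0, forall j, ga (sI e j) = rat_sym j & forall r k, ga (pI e r k) = 0]
    & [/\ forall i, et1 (hA e i) = 0, forall j, et1 (sI e j) = 0 & forall r k, et1 (pI e r k) = p_val true r k]
   /\ [/\ forall i, et2 (hA e i) = 0, forall j, et2 (sI e j) = 0 & forall r k, et2 (pI e r k) = p_val false r k]].

Lemma laurent_mapsP : exists c al be ga et1 et2, laurent_maps c al be ga et1 et2.
Proof.
have z (r : 'Z_3) (k : int) : (0 : K) = - (0 + 0) by rewrite addr0 oppr0.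
have pv0 b r k : ~~ (3 %| k)%Z || (k == 0) -> p_val b r k = 0.
  by rewrite /p_val; case: ifP => //= _ /eqP->; rewrite rat_sym0 mulr0.
have pvN b r k : p_val b r (- k) = p_val b r k.
  by rewrite /p_val rat_symN !dvdzE abszN.
have pvr b k : p_val b 0 k = - (p_val b 1 k + p_val b 2 k).
  by rewrite /p_val; case: ifP => _; rewrite ?addr0 ?oppr0 //; case: b; rewrite /p_coord /=; ring.
have extA (g : int -> K) := @Hhat_linear_ext _ V K _ _ g (fun=> 0) (fun _ _ => 0) hH
  erefl (fun=> erefl) (fun _ _ _ => erefl) (fun _ _ => erefl) (fun k => z 0 k).
have [c hc] := extA (fun=> 1).
have [al ha] := extA (fun i => t ^ i).
have [be hb] := extA (fun i => t ^ (- i)).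
have [ga hg] := @Hhat_linear_ext _ V K _ _ (fun=> 0) rat_sym (fun _ _ => 0) hH
  (rat_sym0 t) (rat_symN t) (fun _ _ _ => erefl) (fun _ _ => erefl) (fun k => z 0 k).
have extP b := @Hhat_linear_ext _ V K _ _ (fun=> 0) (fun=> 0) (p_val b) hH
  erefl (fun=> erefl) (pv0 b) (pvN b) (pvr b).
have [e1 h1] := extP true.
have [e2 h2] := extP false.
by exists c, al, be, ga, e1, e2.
Qed.

Section Maps.
Variables c al be ga et1 et2 : {linear V -> K}.
Hypothesis hmaps : laurent_maps c al be ga et1 et2.

Lemma al_z r k : al (zI e r k) = 0.
Proof. by case: hmaps => _ [_ _ h] _ _ _; rewrite [zI _ _ _]/(_ - _) linearB /= !h subrr. Qed.
Lemma ga_z r k : ga (zI e r k) = 0.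
Proof. by case: hmaps => _ _ _ [_ _ h] _; rewrite [zI _ _ _]/(_ - _) linearB /= !h subrr. Qed.

(** The A-part of a_i s_j is 3/8 (a_{i-j} + a_{i+j} - 2 a_i), which [al] sends to 3/8 of t^i times
    the image of s_j; the P-part never contributes. *)
Lemma al_mul x y : al (m x y) = (c y * al x + c x * al y) / 2 + 3 / 8 * (ga x * al y + ga y * al x).
Proof.
have [[cA cS cP] [aA aS aP] _ [gA gS gP] _] := hmaps.
move: x; apply: (span_ind (rels_span hr)) => [|a x x' hx hx'|b].
- by rewrite (bil0l hm) !linear0; ring.
- by rewrite (bilP hm) !linearP hx hx' !rat_scaleE; field; rewrite ?k2 ?k3 ?k4 ?k8.
move: y; apply: (span_ind (rels_span hr)) => [|a x x' hx hx'|b'].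
- by rewrite (bil0r hm) !linear0; ring.
- by rewrite (bilDr hm) (bilZr hm) !linearP hx hx' !rat_scaleE; field; rewrite ?k2 ?k3 ?k4 ?k8.
have cAS i j : al (m (hA e i) (sI e j)) = 3 / 8 * (rat_sym j * t ^ i).
  rewrite (rels_as hr) linearB /= al_z subr0 !(linearD, linearN, linearZ) /= !aA aS !rat_scaleE.
  rewrite /rat_sym !(rat_tD ratp_inj) !fmorph_div !ratc_nat.
  by field; rewrite ?k2 ?k3 ?k4 ?k8.
have cAP i r k : al (m (hA e i) (pI e r k)) = 0.
  by rewrite (rels_ap hr) linearB linearZ /= !aP scaler0 subr0.
have cSP j r k : (3 %| k)%Z -> al (m (sI e j) (pI e r k)) = 0.
  by move=> h; rewrite (rels_sp hr) // !(linearD, linearN, linearZ) /= !aP !(oppr0, addr0, scaler0).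
have [[i ->]|[j ->]|[r [k [-> hk _]]]] := e_cases e b;
   have [[i' ->]|[j' ->]|[r' [k' [-> hk' _]]]] := e_cases e b';
   rewrite ?cA ?cS ?cP ?aA ?aS ?aP ?gA ?gS ?gP.
- rewrite (rels_aa hr) linearD /= al_z !(linearD, linearZ) /= !aA aS !rat_scaleE.
  by rewrite fmorphV ratc_nat; field; rewrite ?k2 ?k3 ?k4 ?k8.
- by rewrite cAS; ring.
- by rewrite cAP; ring.
- by rewrite (bilC hm) cAS; ring.
- by rewrite (rels_ss hr) !(linearD, linearN, linearZ) /= !aS !(oppr0, addr0, scaler0); ring.
- by rewrite cSP //; ring.
- by rewrite (bilC hm) cAP; ring.
- by rewrite (bilC hm) cSP //; ring.
- rewrite (rels_pp hr) // linearB !linearZ /=.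
  have zD r1 k1 r2 j2 : al (zI e r1 k1 + zI e r2 j2) = 0 by rewrite linearD /= !al_z addr0.
  by rewrite !zD; ring.
Qed.

(** The S-part of a_i a_{i'} has image t^(i-i') + t^(i'-i) - 2, hence the terms in [al], [be] and
    [c]; the last term is [rat_symM]. *)
Lemma ga_mul x y : ga (m x y) = al x * be y + be x * al y - 2 * c x * c y
  + 3 / 2 * (c x * ga y + c y * ga x) - 3 / 8 * ga x * ga y.
Proof.
have [[cA cS cP] [aA aS aP] [bA bS bP] [gA gS gP] _] := hmaps.
move: x; apply: (span_ind (rels_span hr)) => [|a x x' hx hx'|b].
- by rewrite (bil0l hm) !linear0; ring.
- by rewrite (bilP hm) !linearP hx hx' !rat_scaleE; field; rewrite ?k2 ?k3 ?k4 ?k8.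
move: y; apply: (span_ind (rels_span hr)) => [|a x x' hx hx'|b'].
- by rewrite (bil0r hm) !linear0; ring.
- by rewrite (bilDr hm) (bilZr hm) !linearP hx hx' !rat_scaleE; field; rewrite ?k2 ?k3 ?k4 ?k8.
have cAS i j : ga (m (hA e i) (sI e j)) = 3 / 2 * rat_sym j.
  rewrite (rels_as hr) linearB /= ga_z subr0 !(linearD, linearN, linearZ) /= !gA gS !rat_scaleE.
  rewrite !fmorph_div !ratc_nat.
  by field; rewrite ?k2 ?k3 ?k4 ?k8.
have cAP i r k : ga (m (hA e i) (pI e r k)) = 0.
  by rewrite (rels_ap hr) linearB linearZ /= !gP scaler0 subr0.
have cSP j r k : (3 %| k)%Z -> ga (m (sI e j) (pI e r k)) = 0.
  by move=> h; rewrite (rels_sp hr) // !(linearD, linearN, linearZ) /= !gP !(oppr0, addr0, scaler0).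
have [[i ->]|[j ->]|[r [k [-> hk _]]]] := e_cases e b;
   have [[i' ->]|[j' ->]|[r' [k' [-> hk' _]]]] := e_cases e b';
   rewrite ?cA ?cS ?cP ?aA ?aS ?aP ?gA ?gS ?gP ?bA ?bS ?bP.
- rewrite (rels_aa hr) linearD /= ga_z !(linearD, linearZ) /= !gA gS !rat_scaleE.
  by rewrite fmorphV ratc_nat /rat_sym opprD opprK !(rat_tD ratp_inj); field; rewrite ?k2 ?k3 ?k4 ?k8.
- by rewrite cAS; ring.
- by rewrite cAP; ring.
- by rewrite (bilC hm) cAS; ring.
- rewrite (rels_ss hr) !(linearD, linearN, linearZ) /= !gS !rat_scaleE.
  rewrite !fmorph_div !ratc_nat -[_ * _ * rat_sym j']mulrA (rat_symM ratp_inj).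
  by field; rewrite ?k2 ?k3 ?k4 ?k8.
- by rewrite cSP //; ring.
- by rewrite (bilC hm) cAP; ring.
- by rewrite (bilC hm) cSP //; ring.
- rewrite (rels_pp hr) // linearB !linearZ /=.
  have zD r1 k1 r2 j2 : ga (zI e r1 k1 + zI e r2 j2) = 0 by rewrite linearD /= !ga_z addr0.
  by rewrite !zD; ring.
Qed.


Lemma bil_lcl w R y : m (lc w R) y = lc (fun i => m (w i) y) R.
Proof.
rewrite /lc (big_morph (m^~ y) (fun u v => bilDl hm u v y) (bil0l hm y)).
by apply: eq_bigr => i _; rewrite (bilZl hm).
Qed.

Lemma bil_lcr w R y : m y (lc w R) = lc (fun i => m y (w i)) R.
Proof. by rewrite (bilC hm) bil_lcl; apply: eq_lc => i; rewrite (bilC hm). Qed.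

Lemma lc_rat_mull (u : K) w R : lc (fun i => u * w i) R = u * lc w R.
Proof. by rewrite /lc mulr_sumr; apply: eq_bigr => i _; rewrite !rat_scaleE mulrCA. Qed.

Definition psym (R : {poly F}) : K := lc (fun k => rat_sym (3 * k.+1)%N : K) R.

Definition z_coord (b : bool) (r : 'Z_3) : K := p_coord b (r + 1) - p_coord b (r - 1).

(** By [rat_symM], the right-hand side of (H6) is -1/8 times a product of images, in the direction
    of z. *)
Lemma et_lcP_mul (b : bool) (et : {linear V -> K}) r s R R' :
  (forall r k, et (pI e r k) = p_val b r k) ->
  et (m (lcP e r R) (lcP e s R')) = - (z_coord b (- (r + s)) / 8) * (psym R * psym R').
Proof.
move=> hP; rewrite /lcP bil_lcl linear_lc.
have hz r1 (k : int) : (3 %| k)%Z -> et (zI e r1 k) = z_coord b r1 * rat_sym k.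
  move=> hk; rewrite [zI _ _ _]/(_ - _) linearB /= !hP /p_val hk /z_coord.
  by rewrite -mulrBl.
rewrite (eq_lc _ (w' := fun k : nat => (- (z_coord b (- (r + s)) / 8) * psym R')
           * rat_sym (3 * k.+1)%N : K)).
  by rewrite lc_rat_mull -/(psym R) -mulrA [psym R' * _]mulrC.
move=> k; rewrite bil_lcr linear_lc.
rewrite (eq_lc _ (w' := fun j : nat => (- (z_coord b (- (r + s)) / 8) * rat_sym (3 * k.+1)%N)
           * rat_sym (3 * j.+1)%N : K)).
  by rewrite lc_rat_mull -/(psym R') mulrAC.
move=> j.
have d3 (n : nat) : (3 %| (3 * n)%N%:Z)%Z by rewrite dvdzE /= dvdn_mulr.
rewrite (rels_pp hr) //.
have zD r1 k1 r2 j2 : (3 %| k1)%Z -> (3 %| j2)%Z ->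
    et (zI e r1 k1 + zI e r2 j2) = z_coord b r1 * rat_sym k1 + z_coord b r2 * rat_sym j2.
  by move=> h1 h2; rewrite linearD /= !hz.
rewrite linearB !linearZ /= !zD ?d3 //; last 2 first.
- by rewrite !PoszM -mulrBr dvdz_mulr.
- by rewrite -PoszD -mulnDr d3.
rewrite !rat_scaleE !fmorph_div !ratc_nat -[- _ * _ * _]mulrA (rat_symM ratp_inj).
by field; rewrite ?k2 ?k3 ?k4 ?k8.
Qed.

Lemma et_lcP (b : bool) (et : {linear V -> K}) r R :
  (forall r k, et (pI e r k) = p_val b r k) -> et (lcP e r R) = p_coord b r * psym R.
Proof.
move=> hP; rewrite linear_lc -lc_rat_mull; apply: eq_lc => k.
by rewrite hP /p_val dvdzE /= dvdn_mulr.
Qed.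

Lemma a_lcP i r R : m (hA e i) (lcP e r R) = (3 / 2 : F) *: lcP e r R - lcP e (- (zbar i + r)) R.
Proof.
rewrite /lcP bil_lcr /lc scaler_sumr -sumrB; apply: eq_bigr => k _.
by rewrite (rels_ap hr); lmod_coefs F V; ring.
Qed.

Lemma lc_one P : exists d : F, lc (fun=> 1 : K) P = ratc d.
Proof.
exists (\sum_(i < size P) P`_i); rewrite rmorph_sum; apply: eq_bigr => i _.
by rewrite rat_scaleE mulr1.
Qed.

Lemma lcP0 r : lcP e r 0 = 0. Proof. exact: lc0. Qed.

Lemma psym_const R d : psym R = ratc d -> R = 0.
Proof. exact: (lc_sym_const ratp_inj). Qed.


(** The image of F in K. By [psym_const] a P-part with coordinates in it is zero, so it is enough to
    show that coordinates satisfy equations with all roots in F. *)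
Definition rat_const (x : K) : Prop := exists d, x = ratc d.

Lemma rat_const_nat n : rat_const n%:R.
Proof. by exists n%:R; rewrite ratc_nat. Qed.
Lemma rat_constN x : rat_const x -> rat_const (- x).
Proof. by move=> [d ->]; exists (- d); rewrite rmorphN. Qed.
Lemma rat_constD x y : rat_const x -> rat_const y -> rat_const (x + y).
Proof. by move=> [d ->] [d' ->]; exists (d + d'); rewrite rmorphD. Qed.
Lemma rat_constM x y : rat_const x -> rat_const y -> rat_const (x * y).
Proof. by move=> [d ->] [d' ->]; exists (d * d'); rewrite rmorphM. Qed.
Lemma rat_constV x : rat_const x -> rat_const x^-1.
Proof. by move=> [d ->]; exists d^-1; rewrite fmorphV. Qed.

Lemma rat_const_root x y : rat_const y -> x * (3 * x + y) = 0 -> rat_const x.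
Proof.
move=> hy /eqP; rewrite mulf_eq0 => /orP[/eqP->|/eqP h].
  exact: (rat_const_nat 0).
have -> : x = - y / 3.
  apply/eqP; rewrite -subr_eq0; apply/eqP.
  by apply: (comb_eq0 (a := 3^-1) (b := 0) h h); field; rewrite ?k2 ?k3 ?k4 ?k8.
by apply/rat_constM; [apply/rat_constN|apply/rat_constV/rat_const_nat].
Qed.

Lemma rat_const_sqr0 x : x * x = 0 -> rat_const x.
Proof. by move/eqP; rewrite mulf_eq0 orbb => /eqP ->; exact: (rat_const_nat 0). Qed.

Lemma lcP_const R1 R2 : rat_const (psym R1) -> rat_const (psym R2) ->
  lcP e 1 R1 + lcP e 2 R2 = 0.
Proof. by move=> [d /psym_const ->] [d' /psym_const ->]; rewrite !lcP0 addr0. Qed.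

Lemma et_sqr R1 R2 : let q := lcP e 1 R1 + lcP e 2 R2 in
  let u := psym R1 in let v := psym R2 in
  et1 (m q q) = - (u * u + 2 * u * v - 2 * v * v) / 8 /\
  et2 (m q q) = - (2 * u * u - 2 * u * v - v * v) / 8.
Proof.
have [_ _ _ _ [[_ _ h1] [_ _ h2]]] := hmaps.
rewrite /= !(bilDl hm) !(bilDr hm) !linearD /= !(et_lcP_mul _ _ _ _ h1) !(et_lcP_mul _ _ _ _ h2).
by rewrite /z_coord /p_coord /=; split; field; rewrite ?k2 ?k3 ?k4 ?k8.
Qed.

Lemma et_q R1 R2 : let q := lcP e 1 R1 + lcP e 2 R2 in et1 q = psym R1 /\ et2 q = psym R2.
Proof.
have [_ _ _ _ [[_ _ h1] [_ _ h2]]] := hmaps.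
rewrite /= !linearD /= !(et_lcP _ _ h1) !(et_lcP _ _ h2).
by rewrite /p_coord /=; split; ring.
Qed.

(* With h = - (u + v) / 2 and k = (u - v) / 2 the element is p_0(h) + z_0(k), along
   the 1/2- and 5/2-eigenspaces of a_0. *)
Lemma idem_lcP R1 R2 : let q := lcP e 1 R1 + lcP e 2 R2 in m q q = q -> q = 0.
Proof.
move=> q hq; have [E1 E2] := et_sqr R1 R2; have [] := et_q R1 R2.
rewrite -/q -[in et1 _]hq -[in et2 _]hq E1 E2 => {}E1 {}E2.
move: (@lcP_const R1 R2) E1 E2; rewrite -/q; move: (psym R1) (psym R2) => u v hc E1 E2.
pose h := - (u + v) / 2; pose k := (u - v) / 2.
have hu : u = k - h by rewrite /h /k; field; rewrite ?k2 ?k3 ?k4 ?k8.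
have hv : v = - k - h by rewrite /h /k; field; rewrite ?k2 ?k3 ?k4 ?k8.
have D1 : u + (u * u + 2 * u * v - 2 * v * v) / 8 = 0 by apply: (comb_eq0 (a := -1) (b := 0) (eq_subr0 E1) (eq_subr0 E1)); field; rewrite ?k2 ?k3 ?k4 ?k8.
have D2 : v + (2 * u * u - 2 * u * v - v * v) / 8 = 0 by apply: (comb_eq0 (a := -1) (b := 0) (eq_subr0 E2) (eq_subr0 E2)); field; rewrite ?k2 ?k3 ?k4 ?k8.
have H1 : h * (3 * k + 4) = 0.
  by apply: (comb_eq0 (a := -2) (b := -2) D1 D2); rewrite /h /k; field; rewrite ?k2 ?k3 ?k4 ?k8.
have H2 : 3 * k * k - h * h - 8 * k = 0.
  by apply: (comb_eq0 (a := -4) (b := 4) D1 D2); rewrite /h /k; field; rewrite ?k2 ?k3 ?k4 ?k8.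
suff [ch ck] : rat_const h /\ rat_const k.
  by apply: hc; rewrite ?hu ?hv; apply: rat_constD; do ?apply: rat_constN.
(* Either h = 0 and 3 k^2 = 8 k, or k = -4/3 and h^2 = 16; in both cases h and k are constants. *)
move/eqP: H1; rewrite mulf_eq0 => /orP[/eqP h0|/eqP k0].
  split; first by rewrite h0; apply: (rat_const_nat 0).
  apply: (@rat_const_root _ (-8)); first exact/rat_constN/rat_const_nat.
  by apply: (comb_eq0 (a := 1) (b := 0) H2 H2); rewrite h0; field; rewrite ?k2 ?k3 ?k4 ?k8.
have hk : k = - 4 / 3.
  apply/eqP; rewrite -subr_eq0; apply/eqP.
  by apply: (comb_eq0 (a := 3^-1) (b := 0) k0 k0); field; rewrite ?k2 ?k3 ?k4 ?k8.
split; last by rewrite hk; apply/rat_constM; [apply/rat_constN/rat_const_nat|apply/rat_constV/rat_const_nat].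
have : (4 - h) * (4 + h) = 0.
  by apply: (comb_eq0 (a := 1) (b := 0) H2 H2); rewrite hk; field; rewrite ?k2 ?k3 ?k4 ?k8.
move/eqP; rewrite mulf_eq0 => /orP[]/eqP hh.
  by rewrite -[h]addr0 -hh addrC subrK; apply: rat_const_nat.
by rewrite -[h]subr0 -hh opprD addrCA subrr addr0; apply/rat_constN/rat_const_nat.
Qed.

(** Cancelling a_i leaves 2 a_i q + q q = q, two quadratic equations in the coordinates u, v of q
    whose form depends on i modulo 3; all their solutions are constants. *)
Lemma idem_a_lcP i R1 R2 : let q := lcP e 1 R1 + lcP e 2 R2 in
  m (hA e i + q) (hA e i + q) = hA e i + q -> q = 0.
Proof.
move=> q; have [_ _ _ _ [[_ _ h1] [_ _ h2]]] := hmaps.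
have [S1 S2] := et_sqr R1 R2; have [Q1 Q2] := et_q R1 R2; have hc := @lcP_const R1 R2.
have Aq : m (hA e i) q = (3 / 2 : F) *: lcP e 1 R1 - lcP e (- (zbar i + 1)) R1
    + ((3 / 2 : F) *: lcP e 2 R2 - lcP e (- (zbar i + 2)) R2).
  by rewrite /q (bilDr hm) !a_lcP.
rewrite -/q in S1 S2 Q1 Q2 hc; clearbody q.
rewrite !(bilDl hm) !(bilDr hm) (bilC hm q).
have -> : m (hA e i) (hA e i) = hA e i.
  by rewrite (rels_aa hr) subrr sI0 zI0 !addr0; lmod_coefs F V; field; rewrite hF2.
rewrite -!addrA => /addrI hq.
have := congr1 et2 hq; have := congr1 et1 hq.
rewrite !linearD S1 S2 Q1 Q2 Aq.
rewrite !(linearD, linearN, linearZ) /= !(et_lcP _ _ h1) !(et_lcP _ _ h2) !rat_scaleE.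
rewrite !fmorph_div !ratc_nat {S1 S2 Q1 Q2 Aq}.
move: (psym R1) (psym R2) hc => u v hc.
case: (Z3_cases (zbar i)) => ->; rewrite /p_coord /= => E1 E2.
- have D1 : 2 * u - 2 * v - (u * u + 2 * u * v - 2 * v * v) / 8 = 0.
    by apply: (comb_eq0 (a := 1) (b := 0) (eq_subr0 E1) (eq_subr0 E1)); field; rewrite ?k2 ?k3 ?k4 ?k8.
  have D2 : 2 * v - 2 * u - (2 * u * u - 2 * u * v - v * v) / 8 = 0.
    by apply: (comb_eq0 (a := 1) (b := 0) (eq_subr0 E2) (eq_subr0 E2)); field; rewrite ?k2 ?k3 ?k4 ?k8.
  (* The combination is chosen to lose its linear terms and factor; on each factor one quadratic in
     one unknown remains. The other two residues go the same way. *)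
  have /eqP : (u - v) * (u + v) = 0.
    by apply: (comb_eq0 (a := - 8 / 3) (b := - 8 / 3) D1 D2); field; rewrite ?k2 ?k3 ?k4 ?k8.
  rewrite mulf_eq0 => /orP[]; rewrite ?subr_eq0 ?addr_eq0 => /eqP E; subst u.
    suff cv : rat_const v by apply: hc.
    by apply: rat_const_sqr0; apply: (comb_eq0 (a := - 8) (b := 0) D1 D1); field; rewrite ?k2 ?k3 ?k4 ?k8.
  suff cv : rat_const v by apply: hc => //; apply: rat_constN.
  apply: (@rat_const_root _ (- 32)); first exact/rat_constN/rat_const_nat.
  by apply: (comb_eq0 (a := 8) (b := 0) D1 D1); field; rewrite ?k2 ?k3 ?k4 ?k8.
- have D1 : 2 * v - (u * u + 2 * u * v - 2 * v * v) / 8 = 0.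
    by apply: (comb_eq0 (a := 1) (b := 0) (eq_subr0 E1) (eq_subr0 E1)); field; rewrite ?k2 ?k3 ?k4 ?k8.
  have D2 : 4 * v - (2 * u * u - 2 * u * v - v * v) / 8 = 0.
    by apply: (comb_eq0 (a := 1) (b := 0) (eq_subr0 E2) (eq_subr0 E2)); field; rewrite ?k2 ?k3 ?k4 ?k8.
  have /eqP : v * (2 * u - v) = 0.
    by apply: (comb_eq0 (a := - 16 / 3) (b := 8 / 3) D1 D2); field; rewrite ?k2 ?k3 ?k4 ?k8.
  rewrite mulf_eq0 => /orP[]; rewrite ?subr_eq0 => /eqP E; subst v.
    apply: hc; last exact: (rat_const_nat 0).
    by apply: rat_const_sqr0; apply: (comb_eq0 (a := - 8) (b := 0) D1 D1); field; rewrite ?k2 ?k3 ?k4 ?k8.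
  suff cu : rat_const u by apply: hc => //; apply: rat_constM => //; apply: rat_const_nat.
  apply: (@rat_const_root _ 32); first exact: rat_const_nat.
  by apply: (comb_eq0 (a := 8) (b := 0) D1 D1); field; rewrite ?k2 ?k3 ?k4 ?k8.
- have D1 : 4 * u - (u * u + 2 * u * v - 2 * v * v) / 8 = 0.
    by apply: (comb_eq0 (a := 1) (b := 0) (eq_subr0 E1) (eq_subr0 E1)); field; rewrite ?k2 ?k3 ?k4 ?k8.
  have D2 : 2 * u - (2 * u * u - 2 * u * v - v * v) / 8 = 0.
    by apply: (comb_eq0 (a := 1) (b := 0) (eq_subr0 E2) (eq_subr0 E2)); field; rewrite ?k2 ?k3 ?k4 ?k8.
  have /eqP : u * (2 * v - u) = 0.
    by apply: (comb_eq0 (a := - 8 / 3) (b := 16 / 3) D1 D2); field; rewrite ?k2 ?k3 ?k4 ?k8.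
  rewrite mulf_eq0 => /orP[]; rewrite ?subr_eq0 => /eqP E; subst u.
    apply: hc; first exact: (rat_const_nat 0).
    by apply: rat_const_sqr0; apply: (comb_eq0 (a := 4) (b := 0) D1 D1); field; rewrite ?k2 ?k3 ?k4 ?k8.
  suff cv : rat_const v by apply: hc => //; apply: rat_constM => //; apply: rat_const_nat.
  apply: (@rat_const_root _ (- 32)); first exact/rat_constN/rat_const_nat.
  by apply: (comb_eq0 (a := - 4) (b := 0) D1 D1); field; rewrite ?k2 ?k3 ?k4 ?k8.
Qed.

(** The A-coordinate of x x = x is a product equal to 0. Either the A-part vanishes, or the S-part
    is constant, hence zero; the weight is then 1 and the A-part an invertible Laurent
    polynomial. *)
Lemma idempotent_cases_maps x : m x x = x -> x = 0 \/ exists i, x = hA e i.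
Proof.
move=> hx; have [N [P [Q [R1 [R2 xE]]]]] := normal_form (rels_span hr) x.
have [[cA cS cP] [aA aS aP] [bA bS bP] [gA gS gP] _] := hmaps.
have zP (f : {linear V -> K}) r R : (forall r k, f (pI e r k) = 0) -> f (lcP e r R) = 0.
  by move=> h; rewrite linear_lc /lc big1 // => i _; rewrite h scaler0.
have zS (f : {linear V -> K}) : (forall j, f (sI e j) = 0) -> f (lcS e Q) = 0.
  by move=> h; rewrite linear_lc /lc big1 // => i _; rewrite h scaler0.
have Ea : al x = lc (fun i => t ^ (i%:Z - N%:Z) : K) P.
  rewrite xE !linearD /= !(zP al) // (zS al) // !addr0 linear_lc.
  by apply: eq_lc => i; rewrite aA.
have Eb : be x = lc (fun i => t ^ (N%:Z - i%:Z) : K) P.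
  rewrite xE !linearD /= !(zP be) // (zS be) // !addr0 linear_lc.
  by apply: eq_lc => i; rewrite bA opprB.
have Eg : ga x = lc (fun j => rat_sym (1 * j.+1)%N : K) Q.
  rewrite xE !linearD /= !(zP ga) // !addr0.
  have -> : ga (lcA e N P) = 0 by rewrite linear_lc /lc big1 // => i _; rewrite gA scaler0.
  by rewrite add0r linear_lc; apply: eq_lc => j; rewrite gS.
have Ec : c x = lc (fun=> 1 : K) P.
  rewrite xE !linearD /= !(zP c) // (zS c) // !addr0 linear_lc.
  by apply: eq_lc => i; rewrite cA.
have [d Ed] := lc_one P; rewrite Ed in Ec.
have hal := al_mul x x; have hga := ga_mul x x; rewrite hx in hal hga.
have Q0 : rat_const (ga x) -> ga x = 0 /\ Q = 0.
  move=> [d' hd]; have Q0 : Q = 0 by apply: (lc_sym_const ratp_inj (isT : (0 < 1)%N)); rewrite -Eg; exact: hd.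
  by rewrite Eg Q0 lc0.
have : al x * (c x + 3 / 4 * ga x - 1) = 0.
  by apply: (comb_eq0 (a := -1) (b := 0) (eq_subr0 hal) (eq_subr0 hal)); field; rewrite ?k2 ?k3 ?k4 ?k8.
move/eqP; rewrite mulf_eq0 => /orP[]/eqP.
  move=> a0; left.
  have P0 : P = 0.
    apply: ratp_inj; rewrite rmorph0 (ratp_lcX ratc t P).
    rewrite (eq_lc _ (w' := fun i : nat => t ^ N%:Z * t ^ (i%:Z - N%:Z) : K)).
      by rewrite lc_rat_mull -Ea a0 mulr0.
    by move=> i; rewrite -(rat_tD ratp_inj) addrC subrK.
  have b0 : be x = 0 by rewrite Eb P0 lc0.
  have c0 : c x = 0 by rewrite Ec -Ed P0 lc0.
  (* Without A-part the S-coordinate satisfies g (3 g + 8) = 0. *)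
  have [g0 Q00] : ga x = 0 /\ Q = 0.
    apply/Q0/(@rat_const_root _ 8); first exact: rat_const_nat.
    rewrite a0 b0 c0 in hga.
    by apply: (comb_eq0 (a := 8) (b := 0) (eq_subr0 hga) (eq_subr0 hga)); field; rewrite ?k2 ?k3 ?k4 ?k8.
  move: hx; rewrite xE P0 Q00 /lcA /lcS !lc0 !add0r.
  exact: idem_lcP.
move=> hg.
have [g0 Q00] : ga x = 0 /\ Q = 0.
  apply: Q0.
  have -> : ga x = 4 / 3 * (1 - c x).
    apply/eqP; rewrite -subr_eq0; apply/eqP.
    by apply: (comb_eq0 (a := 4 / 3) (b := 0) hg hg); field; rewrite ?k2 ?k3 ?k4 ?k8.
  apply: rat_constM; first by apply: rat_constM; [|apply: rat_constV]; apply: rat_const_nat.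
  by apply: rat_constD; [apply: (rat_const_nat 1)|apply: rat_constN; rewrite Ec; exists d].
have c1 : c x = 1 by apply/eqP; rewrite -subr_eq0 -hg g0 mulr0 addr0.
have ab : al x * be x = 1.
  rewrite g0 c1 in hga.
  apply/eqP; rewrite -subr_eq0; apply/eqP.
  by apply: (comb_eq0 (a := - 2^-1) (b := 0) (eq_subr0 hga) (eq_subr0 hga)); field; rewrite ?k2 ?k3 ?k4 ?k8.
rewrite Ea Eb in ab; have [c' [k Pk]] := lc_unit ratp_inj ab.
(* The coefficient of the monomial is the weight of x. *)
have c'1 : c' = 1.
  apply: (fmorph_inj ratc); rewrite rmorph1 -c1 Ec -Ed Pk.
  by rewrite -[c' *: _]addr0 lc_linear lc0 lcXn addr0 rat_scaleE mulr1.
right; exists (k%:Z - N%:Z).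
have xE' : x = hA e (k%:Z - N%:Z) + (lcP e 1 R1 + lcP e 2 R2).
  by rewrite xE Q00 Pk c'1 scale1r /lcA /lcS lc0 lcXn addr0.
move: hx; rewrite xE' => /idem_a_lcP ->.
by rewrite addr0.
Qed.

End Maps.

Lemma idempotent_cases x : m x x = x -> x = 0 \/ exists i, x = hA e i.
Proof.
have [c [al [be [ga [et1 [et2 h]]]]]] := laurent_mapsP.
exact: (idempotent_cases_maps h).
Qed.
End Idempotents.

(** * Automorphisms *)

Section FractionField.
Variable F : fieldType.

Definition frac_const : {rmorphism F -> {fraction {poly F}}} :=
  (@FracField.tofrac {poly F}) \o polyC.

(** In the fraction field with t = X, evaluation at t is the inclusion of the polynomials. *)
Lemma frac_ratp_inj : injective (ratp frac_const (@FracField.tofrac {poly F} 'X)).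
Proof.
have E P : ratp frac_const (@FracField.tofrac {poly F} 'X) P = FracField.tofrac P.
  rewrite /ratp /= /horner_eval map_poly_comp horner_map; congr FracField.tofrac.
  exact: comp_polyXr.
by move=> P Q; rewrite !E => /eqP; rewrite tofrac_eq => /eqP.
Qed.
End FractionField.

Section Automorphisms.
Variables (F : fieldType) (V : lmodType F) (m : V -> V -> V) (e : hidx -> V).
Hypothesis hF2 : (2%:R : F) != 0.
Hypothesis hF3 : (3%:R : F) != 0.
Hypothesis hH : is_Hhat m e.

Let hr := Hhat_rels hF2 hH.
Let hm := rels_bil hr.
Let nz4 := nz4 hF2.
Let nz8 := nz8 hF2.
Let a := hA e.

Lemma hA_inj : injective a.
Proof.
case: hH => _ [hfree _] _ i j hij; apply/eqP/negPn/negP => nij.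
pose b i : hidx := inl (inl i); pose cf x : F := if x == b i then 1 else -1.
have u : uniq [:: b i; b j] by rewrite /= inE andbT; apply: contra nij => /eqP[->].
have := hfree [:: b i; b j] cf u; rewrite !big_cons big_nil /cf eqxx addr0.
have -> : (b j == b i) = false by apply/negP => /eqP[E]; move: nij; rewrite E eqxx.
rewrite scale1r scaleN1r -[e (b i)]/(a i) -[e (b j)]/(a j) hij subrr.
move=> /(_ erefl (b i)); rewrite inE eqxx => /(_ isT) /eqP.
by rewrite oner_eq0.
Qed.

Lemma hA_neq0 i : a i <> 0.
Proof.
case: hH => _ [hfree _] _ h; have := hfree [:: inl (inl i)] (fun=> 1) isT.
rewrite big_seq1 scale1r -[e _]/(a i) h => /(_ erefl (inl (inl i))).
by rewrite inE eqxx => /(_ isT)/eqP; rewrite oner_eq0.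
Qed.

Lemma a_idem i : m (a i) (a i) = a i.
Proof.
by rewrite (rels_aa hr) subrr sI0 zI0 !addr0; lmod_coefs F V; field; rewrite hF2.
Qed.

Section OneAut.
Variable f : V -> V.
Hypothesis hf : alg_aut m f.

Lemma autL (c : F) x y : f (c *: x + y) = c *: f x + f y.
Proof. by case: hf => -[h _] _; exact: h. Qed.
Lemma autM x y : f (m x y) = m (f x) (f y).
Proof. by case: hf => -[_ h] _; exact: h. Qed.
Lemma autD x y : f (x + y) = f x + f y.
Proof. by rewrite -[x]scale1r autL !scale1r. Qed.
Lemma aut0 : f 0 = 0.
Proof. by apply: (addrI (f 0)); rewrite -autD !addr0. Qed.
Lemma autZ c x : f (c *: x) = c *: f x.
Proof. by rewrite -[c *: x]addr0 autL aut0 addr0. Qed.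
Lemma autN x : f (- x) = - f x.
Proof. by rewrite -!scaleN1r autZ. Qed.
Lemma aut_inj : injective f.
Proof. by case: hf => _; exact: bij_inj. Qed.

(** The image of a_i is an idempotent, nonzero by injectivity. *)
Lemma aut_a i : exists j, f (a i) = a j.
Proof.
have : m (f (a i)) (f (a i)) = f (a i) by rewrite -autM a_idem.
case/(idempotent_cases hF2 hF3 hH (@frac_ratp_inj F)) => // h.
by case: (@hA_neq0 i); apply: aut_inj; rewrite aut0.
Qed.

(* a_i s_1 determines a_{i-1} + a_{i+1}, hence f maps arithmetic progressions to
   arithmetic progressions. *)
Lemma aut_step i (d : int) x y : `|d|%N = 1%N -> f (a (i - d)) = a x -> f (a i) = a y ->
  f (a (i + d)) = a (y + (y - x)).
Proof.
move=> hd hx hy; have sE : sI e 1 = m (a i) (a (i - d)) - (2^-1 : F) *: (a i + a (i - d)).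
  rewrite (rels_aa hr) -/a (_ : i - (i - d) = d); last by ring.
  rewrite (zI_unit _ _ hd) -(sI_unit e hd).
  by lmod_coefs F V; ring.
have zM r k : m (a y) (zI e r k) = (3 / 2 : F) *: zI e r k
    - (pI e (- (zbar y + (r + 1))) k - pI e (- (zbar y + (r - 1))) k).
  rewrite /zI (bilDr hm) (bilNr hm) !(rels_ap hr).
  by lmod_coefs F V; ring.
have fs : f (sI e 1) = sI e (y - x) + zI e (zbar y) (y - x).
  rewrite sE autD autN autZ autM autD hx hy (rels_aa hr) -/a.
  by lmod_coefs F V; ring.
rewrite /a (a_next hF2 hF3 hr i hd) !autD !autN !autZ autM -/a fs hx hy.
rewrite (bilDr hm) (rels_as hr) -/a zM.
(* As -2 y = y in Z_3, z_{y,k} is a 5/2-eigenvector of a_y. With the -z of (H2) this gives 3/2 z,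
   which the factor 8/3 turns into 4 z, cancelled by the z-part of -4 f(s_1). *)
have -> : - (zbar y + (zbar y + 1)) = zbar y - 1.
  by case: (Z3_cases (zbar y)) => ->; apply: val_inj.
have -> : - (zbar y + (zbar y - 1)) = zbar y + 1.
  by case: (Z3_cases (zbar y)) => ->; apply: val_inj.
have -> : y - (y - x) = x by ring.
have -> : zI e (zbar y) (y - x) = pI e (zbar y + 1) (y - x) - pI e (zbar y - 1) (y - x) by [].
by lmod_coefs F V; field; rewrite ?hF2 ?hF3 ?nz4 ?nz8.
Qed.

Lemma aut_affine : exists k l, forall n, f (a n) = a (k + l * n).
Proof.
have [k h0] := aut_a 0; have [k' h1] := aut_a 1.
exists k, (k' - k) => n.
suff : f (a n) = a (k + (k' - k) * n) /\ f (a (n + 1)) = a (k + (k' - k) * (n + 1)) by case.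
elim: n => [|n [IH1 IH2]|n [IH1 IH2]].
- by rewrite add0r h0 h1 mulr0 mulr1 addr0 addrC subrK.
- have -> : n.+1%:Z = n%:Z + 1 by rewrite intS addrC.
  split=> //; rewrite -[X in a X](addrK 1) in IH1.
  by rewrite (aut_step (d := 1) erefl IH1 IH2); congr a; ring.
have -> : - n.+1%:Z = - n%:Z - 1 by rewrite intS opprD addrC.
rewrite subrK; split=> //.
rewrite -[X in - n%:Z + X]opprK in IH2.
by rewrite (aut_step (d := -1) erefl IH2 IH1); congr a; ring.
Qed.
End OneAut.

Lemma aut_inv f g : alg_aut m f -> cancel f g -> cancel g f -> alg_aut m g.
Proof.
move=> hf fK gK; split; last by exists f.
split=> [c x y|x y]; apply: (aut_inj hf).
  by rewrite (autL hf) !gK.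
by rewrite (autM hf) !gK.
Qed.

(** The inverse is affine on indices too, so the two integer slopes have product 1. *)
Lemma aut_slope f : alg_aut m f ->
  exists k, (forall n, f (a n) = a (k - n)) \/ (forall n, f (a n) = a (k + n)).
Proof.
move=> hf; have [_ [g fK gK]] := hf; have hg := aut_inv hf fK gK.
have [k [l h]] := aut_affine hf; have [k' [l' h']] := aut_affine hg.
have E n : k + l * (k' + l' * n) = n by apply: hA_inj; rewrite -h -h' gK.
exists k; have /eqP : l * l' = 1 by have := E 0; have := E 1; lia.
move=> /eqP ll; have [l1|l1] : l = 1 \/ l = -1.
  have : l \is a GRing.unit by apply/unitrP; exists l'; rewrite mulrC ll.
  by rewrite unfold_in /= => /orP[/eqP|/eqP]; [left|right].
- by right=> n; rewrite h l1 mul1r.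
- by left=> n; rewrite h l1 mulN1r.
Qed.

(** * From two reflections to all automorphisms *)

Section Ideals.
Variable I : V -> Prop.
Hypothesis hI : is_ideal m I.

(** An odd number of reflections composes to a reflection; three of them allow an induction on n
    that uses only rho_0 and rho_1. *)
Lemma refl_comp n1 n2 n3 (r1 r2 r3 r : {linear V -> V}) :
  is_refl e n1 r1 -> is_refl e n2 r2 -> is_refl e n3 r3 -> is_refl e (n1 - n2 + n3) r ->
  forall x, r x = r1 (r2 (r3 x)).
Proof.
move=> [A1 S1 P1] [A2 S2 P2] [A3 S3 P3] [A0 S0 P0].
apply: (span_ind (rels_span hr)) => [|c x y hx hy|b].
- by rewrite !linear0.
- by rewrite !linearP hx hy.
case: (e_cases e b) => [[i ->]|[j ->]|[q [k [-> _ _]]]].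
- by rewrite A3 A2 A1 A0; congr hA; ring.
- by rewrite S3 S2 S1 S0.
- rewrite P0 P3 linearN P2 opprK P1; congr (- pI e _ _).
  rewrite !zbarD zbarN !opprB -!addrA; congr (_ + _).
  by rewrite addrC -addrA.
Qed.

Lemma ideal_refl_all n (rho : {linear V -> V}) : is_refl e n rho -> forall x, I x -> I (rho x).
Proof.
have [[lam hlam] hex] := Hhat_weight_refl hH.
have [r0 h0] := hex 0; have [r1 h1] := hex 1.
have I0 := ideal_refl0 hF2 hF3 hr hlam hI h0; have I1 := ideal_refl1 hF2 hF3 hr hlam hI h1.
elim: n rho => [|n IH|n IH] rho hrho x hx.
- exact: (ideal_refl0 hF2 hF3 hr hlam hI hrho).
- have [rn hn] := hex n.
  have E : n.+1%:Z = 1 - 0 + n%:Z by rewrite intS subr0.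
  rewrite E in hrho; rewrite (refl_comp h1 h0 hn hrho).
  by apply/I1/I0/(IH _ hn).
- have [rn hn] := hex (- n%:Z).
  have E : - n.+1%:Z = 0 - 1 + (- n%:Z) by rewrite intS opprD sub0r.
  rewrite E in hrho; rewrite (refl_comp h0 h1 hn hrho).
  by apply/I0/I1/(IH _ hn).
Qed.

(** On the a's, f agrees with rho_k or with the translation rho_k rho_0. *)
Lemma aut_ideal f : alg_aut m f -> forall x, I x -> I (f x).
Proof.
move=> hf x hx; have [_ hex] := Hhat_weight_refl hH.
(* Two homomorphisms agree on a subalgebra; here it contains the generators a_0 and a_1. *)
have gen g : (forall c x y, g (c *: x + y) = c *: g x + g y) -> g 0 = 0 ->
    (forall x y, g (m x y) = m (g x) (g y)) ->
    (forall n, f (a n) = g (a n)) -> f x = g x.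
  move=> gL g0 gM fg.
  apply: (cover_generated hF2 hF3 hr (S := fun x => f x = g x)) => //.
  split; first by rewrite g0 (aut0 hf).
  by split=> [c u v|u v] hu hv; rewrite ?(autL hf) ?(autM hf) hu hv.
have [k [h|h]] := aut_slope hf; have [rk hk] := hex k.
  rewrite (gen rk); first exact: (ideal_refl_all hk).
  - exact: linearP.
  - exact: linear0.
  - exact: (reflM hr hk).
  - by move=> n; rewrite h; case: hk => ->.
have [r0 h0] := hex 0.
rewrite (gen (rk \o r0)) /=.
- by apply/(ideal_refl_all hk)/(ideal_refl_all h0).
- by move=> c u v /=; rewrite !linearP.
- by rewrite /= !linear0.
- by move=> u v /=; rewrite !(reflM hr h0) !(reflM hr hk).
- by move=> n /=; rewrite h; case: h0 => -> _ _; case: hk => -> _ _; rewrite sub0r opprK.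
Qed.
End Ideals.

Lemma Hhat_aut_invariant I : is_ideal m I -> aut_invariant m I.
Proof.
move=> hI f hf x; split; first exact: (aut_ideal hI hf).
have [_ [g fK gK]] := hf; move=> /(aut_ideal hI (aut_inv hf fK gK)).
by rewrite fK.
Qed.
End Automorphisms.

Theorem theorem1p4 (F : fieldType) (hF2 : (2%:R : F) != 0) (hF3 : (3%:R : F) != 0) :
  (forall (V : lmodType F) (m : V -> V -> V) (e : hidx -> V),
     is_Hhat m e -> forall I : V -> Prop, is_ideal m I -> aut_invariant m I) /\
  (forall (V : lmodType F) (m : V -> V -> V) (e : hidx -> V),
     is_Hhat m e -> forall I : V -> Prop, is_ideal m I -> proper_set I ->
     forall (Q : lmodType F) (mQ : Q -> Q -> Q) (phi : V -> Q),
       quotient_by m mQ I phi -> symmetric_alg mQ (phi (hA e 0)) (phi (hA e 1))) /\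
  (forall (V : lmodType F) (m : V -> V -> V) (e : widx -> V),
     is_Highwater m e -> forall I : V -> Prop, is_ideal m I -> proper_set I ->
     forall (Q : lmodType F) (mQ : Q -> Q -> Q) (phi : V -> Q),
       quotient_by m mQ I phi -> symmetric_alg mQ (phi (wA e 0)) (phi (wA e 1))).
Proof.
split; [|split].
- by move=> V m e hH I hI; apply: (Hhat_aut_invariant hF2 hF3 hH).
- move=> V m e hH I hI _ Q mQ phi hq; have [[lam hlam] hex] := Hhat_weight_refl hH.
  have [rho hrho] := hex 1.
  exact: (quotient_symmetric hF2 hF3 (Hhat_rels hF2 hH) hlam hI hrho hq).
- move=> V m e hH I hI _ Q mQ phi hq; have [[lam hlam] hex] := Highwater_weight_refl hH.
  have [rho hrho] := hex 1.
  exact: (quotient_symmetric hF2 hF3 (Highwater_rels hF2 hH) hlam hI hrho hq).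
Qed.
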